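(* Let $d\geq 2$, let $\mathbf{x}\in\mathbb{R}^{d-1}$, and consider the line $\{\mathbf{x}\}\times\mathbb{R}\subseteq\mathbb{R}^d$. (i) If the dual Diophantine type of $\mathbf{x}$ is strictly greater than $d$, then $\{\mathbf{x}\}\times\mathbb{R}\subseteq \mathrm{VWA}_d$, where \[\mathrm{VWA}_d=\{\mathbf{y}\in\mathbb{R}^d : \exists\varepsilon>0 \text{ such that } \|q\mathbf{y}\|<q^{-1/d-\varepsilon} \text{ for infinitely many } q\in\mathbb{N}\}.\] (ii) If the dual Diophantine type of $\mathbf{x}$ is strictly less than $d$, then $\{\mathbf{x}\}\times\mathbb{R}$ is of Khintchine type for divergence: for every nonincreasing $\psi:\mathbb{N}\to\mathbb{R}^+$ with $\sum_{q\in\mathbb{N}}\psi(q)^d=\infty$, Lebesgue almost every $y\in\mathbb{R}$ is such that $(\mathbf{x},y)$ is $\psi$-approximable.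
   Context: For a vector $\mathbf{z}$ (or a real number), $\|\mathbf{z}\|$ denotes the sup-norm distance from $\mathbf{z}$ to the nearest integer point. Given $\psi:\mathbb{N}\to\mathbb{R}^+$, a vector $\mathbf{y}\in\mathbb{R}^d$ is $\psi$-approximable if $\|q\mathbf{y}\|<\psi(q)$ for infinitely many $q\in\mathbb{N}$. The dual Diophantine type of $\mathbf{x}\in\mathbb{R}^\ell$ is \[\tau_D(\mathbf{x})=\sup\{\tau\in\mathbb{R}^+ : \|\langle \mathbf{n},\mathbf{x}\rangle\|<|\mathbf{n}|_\infty^{-\tau}\text{ for infinitely many }\mathbf{n}\in\mathbb{Z}^\ell\setminus\{\mathbf{0}\}\},\] where $\langle\cdot,\cdot\rangle$ is the standard inner product and $|\cdot|_\infty$ the sup norm. *)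

(* Defs.v *)
From HB Require Import structures.
From mathcomp Require Import all_boot all_order all_algebra.
From mathcomp Require Import all_classical all_reals all_analysis.

Set Implicit Arguments.
Unset Strict Implicit.
Unset Printing Implicit Defensive.

Import Order.TTheory GRing.Theory Num.Theory.
Import numFieldNormedType.Exports.

Local Open Scope classical_set_scope.
Local Open Scope ring_scope.

Definition int_vec (R : realType) (n : nat) (p : 'rV[int]_n) : 'rV[R]_n :=
  map_mx intr p.

Definition dist_int (R : realType) (t : R) : R :=
  inf [set `|t - p%:~R| | p in [set: int]].

(* The norm of the library on ['rV[R]_n] is the sup norm. *)
Definition dist_int_vec (R : realType) (n : nat) (z : 'rV[R]_n) : R :=
  inf [set `|z - int_vec R p| | p in [set: 'rV[int]_n]].

Definition inner (R : realType) (n : nat) (u v : 'rV[R]_n) : R :=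
  \sum_(i < n) u 0 i * v 0 i.

(* The natural numbers [q] are the positive ones; [psi 0] is irrelevant. *)
Definition psi_approximable (R : realType) (d : nat) (psi : nat -> R)
    (y : 'rV[R]_d) : Prop :=
  infinite_set [set q : nat | (0 < q)%N /\ dist_int_vec (q%:R *: y) < psi q].

Definition VWA (R : realType) (d : nat) : set 'rV[R]_d :=
  [set y | exists2 eps : R, 0 < eps &
     psi_approximable (fun q => q%:R `^ (- d%:R^-1 - eps)) y].

(* The supremum is taken in the extended reals, as it may be infinite. *)
Definition dual_type (R : realType) (l : nat) (x : 'rV[R]_l) : \bar R :=
  ereal_sup [set tau%:E | tau in [set tau : R | 0 < tau /\
    infinite_set [set n : 'rV[int]_l | n != 0 /\
      dist_int (inner (int_vec R n) x) < `|int_vec R n| `^ (- tau)]]].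

(* The point (x, y) of R^d: the first [d.-1] coordinates are those of [x], and
   [insub] fails on the last index only, where the coordinate is [y]. *)
Definition line_point (R : realType) (d : nat) (x : 'rV[R]_d.-1) (y : R) :
    'rV[R]_d :=
  \row_(i < d) (if insub (val i) is Some j then x 0 j else y).

Definition line (R : realType) (d : nat) (x : 'rV[R]_d.-1) : set 'rV[R]_d :=
  [set line_point x y | y in [set: R]].

Definition khintchine_divergence_line (R : realType) (d : nat)
    (x : 'rV[R]_d.-1) : Prop :=
  forall psi : nat -> R,
    (forall q, (0 < q)%N -> 0 < psi q) ->
    (forall p q, (0 < p)%N -> (p <= q)%N -> psi q <= psi p) ->
    (\sum_(1 <= q <oo) (psi q ^+ d)%:E = +oo)%E ->
    {ae @lebesgue_measure R, forall y : R,
      psi_approximable psi (line_point x y)}.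

(* Main.v *)
(** (i) If [||<n,x>||] is much smaller than [|n|^-d], then [n] and its approximation
    [m] cut out a sublattice of [Z^d+1] close to the hyperplane orthogonal to
    [(n,0)]; the pigeonhole principle applied to [q -> (q x, q y)], with the
    coordinate where [|n|] is attained replaced by the integer
    [q m - <n, floor(q x)>], gives [q] such that [||q (x,y)||] is too small,
    for every [y].

    (ii) The type condition bounds [#{q <= r : ||q x|| < a}] by [C r a^(d-1)] for
    [r] not too small with respect to [a]; this is a large sieve argument, the
    numbers [<k,x>] with [|k| <= N ~ 1/a] being well separated modulo 1.  With
    Dirichlet's theorem it follows that the fractions [p/q] with [q] of order
    [Q] and [||q x|| < psi(Q)] are well distributed in every interval: they
    contain a positive proportion of a grid of mesh [1/(Q^2 psi(Q)^(d-1))].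
    Along [Q = 16^k], the balls of radius [~psi(Q)/Q] around these fractions have
    measures of divergent sum (Cauchy condensation) and are independent enough for
    the Bonferroni inequality to show that finitely many of them cover a fixed
    proportion of the interval.  Lebesgue's density theorem concludes. *)

Require Import Defs.
From HB Require Import structures.
From mathcomp Require Import all_boot all_order all_algebra.
From mathcomp Require Import all_classical all_reals all_analysis.
From mathcomp Require Import ring lra zify.
Import Order.TTheory GRing.Theory Num.Theory.
Import numFieldNormedType.Exports.
Local Open Scope classical_set_scope.
Local Open Scope ring_scope.
Set Implicit Arguments.
Unset Strict Implicit.

(** * Distance to the integers, the sup norm, and boxes for the pigeonhole principle *)

Lemma dist_int_le (R : realType) (t : R) (p : int) : dist_int t <= `|t - p%:~R|.
Proof. by apply: ge_inf; [exists 0 => _ [m _ <-] | exists p]. Qed.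

Lemma dist_int_lt (R : realType) (t e : R) :
  dist_int t < e -> exists p : int, `|t - p%:~R| < e.
Proof.
move=> /inf_lt[]; first by exists `|t - 0%:~R|, 0.
by move=> _ [p _ <-] ?; exists p.
Qed.

Lemma dist_int_vec_lt (R : realType) (n : nat) (z : 'rV[R]_n) (e : R) :
  0 < e -> (forall i, exists p : int, `|z 0 i - p%:~R| < e) ->
  dist_int_vec z < e.
Proof.
move=> e0 /fin_all_exists[p zp].
have : `|z - int_vec R (\row_i p i)| < e.
  rewrite [X in X < _]mx_normrE; apply: bigmax_lt => // -[i j] _ /=.
  by rewrite (ord1 i) !mxE.
apply: le_lt_trans; apply: ge_inf; last by exists (\row_i p i).
by exists 0 => _ [m _ <-].
Qed.

Lemma line_point_approx (R : realType) (d : nat) (x : 'rV[R]_d.-1) (y e : R)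
    (q : nat) : 0 < e ->
  (forall i, exists p : int, `|q%:R * x 0 i - p%:~R| < e) ->
  (exists p : int, `|q%:R * y - p%:~R| < e) ->
  dist_int_vec (q%:R *: line_point x y) < e.
Proof.
move=> e0 hx hy; apply: dist_int_vec_lt => // i; rewrite !mxE.
by case: insub => [j|].
Qed.

Lemma sup_norm_ge (R : realType) (n : nat) (z : 'rV[R]_n) i : `|z 0 i| <= `|z|.
Proof.
rewrite [leRHS]mx_normrE.
by apply: (@le_bigmax _ _ _ 0 (fun ij => `|z ij.1 ij.2|) (0, i)).
Qed.

Lemma sup_norm_attained (R : realType) (n : nat) (z : 'rV[R]_n) :
  z != 0 -> exists i, `|z| = `|z 0 i|.
Proof.
move=> z0; have /mx_norm_neq0[[i j] /= h] : mx_norm z != 0.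
  by apply: contra z0 => /eqP /mx_norm_eq0 ->.
by exists j; rewrite -(ord1 i).
Qed.

Lemma int_vec_neq0 (R : realType) (n : nat) (p : 'rV[int]_n) :
  p != 0 -> int_vec R p != 0.
Proof.
apply: contra => /eqP p0; apply/eqP/rowP => i.
have /rowP/(_ i) := p0; rewrite !mxE => /eqP.
by rewrite intr_eq0 => /eqP.
Qed.

Lemma int_vec_norm_nat (R : realType) (n : nat) (p : 'rV[int]_n) :
  p != 0 -> exists i, [/\ (0 < absz (p 0%R i))%N,
    `|int_vec R p| = (absz (p 0 i))%:R :> R & forall j, (absz (p 0%R j) <= absz (p 0%R i))%N].
Proof.
move=> p0; have [i pi] := sup_norm_attained (int_vec_neq0 R p0).
have e j : `|int_vec R p 0 j| = (absz (p 0 j))%:R :> R.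
  by rewrite mxE -intr_norm -abszE.
exists i; split => //; last 2 first.
- by rewrite pi e.
- by move=> j; rewrite -(ler_nat R) -!e -pi sup_norm_ge.
rewrite -(ltr_nat R) -e -pi normr_gt0; exact: int_vec_neq0.
Qed.

Lemma pigeonhole_leq (T : finType) (Q : nat) (f : nat -> T) : (#|T| <= Q)%N ->
  exists i j, [/\ (i < j)%N, (j <= Q)%N & f i = f j].
Proof.
move=> TQ; apply: contrapT => H.
have inj : injective (fun i : 'I_Q.+1 => f i).
  move=> i j fij; apply/val_inj; case: (ltngtP i j) => // ij; case: H.
    by exists i, j; split=> //; rewrite -ltnS.
  by exists j, i; split=> //; rewrite -ltnS.
by have := leq_card _ inj; rewrite card_ord ltnNge TQ.
Qed.

Definition fracpart (R : realType) (t : R) : R := t - (Num.floor t)%:~R.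

Lemma fracpart_itv (R : realType) (t : R) : 0 <= fracpart t < 1.
Proof.
rewrite /fracpart subr_ge0 floor_le /= ltrBlDl.
by have /andP[_] := floor_itv t; rewrite intrD.
Qed.

(** The boxes of Dirichlet's argument: the index of the interval of length [1/(N+1)] of [[0, 1)]
    that contains the fractional part. The truncation is at most [N], so [inord] never falls back on
    its default. *)
Definition cell (R : realType) (N : nat) (t : R) : 'I_N.+1 :=
  inord (Num.truncn (N.+1%:R * fracpart t)).

Lemma cell_eq (R : realType) (N : nat) (s t : R) :
  cell N s = cell N t -> `|fracpart s - fracpart t| < N.+1%:R^-1.
Proof.
have b (v : R) : 0 <= N.+1%:R * fracpart v /\
    (Num.truncn (N.+1%:R * fracpart v) < N.+1)%N.
  have /andP[v0 v1] := fracpart_itv v.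
  have p : 0 <= N.+1%:R * fracpart v by rewrite mulr_ge0.
  by split=> //; rewrite truncn_lt_nat // gtr_pMr.
move=> /(congr1 val); rewrite /= !inordK ?(b s).2 ?(b t).2 // => e.
have /andP[s1 s2] := truncn_itv (b s).1; have /andP[t1 t2] := truncn_itv (b t).1.
move: s1 s2 t1 t2; rewrite e -!(natr1 (Num.truncn _)) => s1 s2 t1 t2.
rewrite -(@ltr_pM2l _ N.+1%:R) ?ltr0n // mulfV ?pnatr_eq0 //.
rewrite -[X in X * _]ger0_norm // -normrM mulrBr ltr_norml.
by apply/andP; split; lra.
Qed.

Lemma cell_approx (R : realType) (N i j : nat) (t : R) : (i <= j)%N ->
  cell N (i%:R * t) = cell N (j%:R * t) ->
  exists p : int, `|(j - i)%:R * t - p%:~R| < N.+1%:R^-1.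
Proof.
move=> ij /esym /cell_eq h; exists (Num.floor (j%:R * t) - Num.floor (i%:R * t)).
rewrite natrB // intrB.
suff -> : (j%:R - i%:R) * t - ((Num.floor (j%:R * t))%:~R - (Num.floor (i%:R * t))%:~R)
  = fracpart (j%:R * t) - fracpart (i%:R * t) by [].
by rewrite /fracpart; ring.
Qed.

(** * Trigonometric sums *)

Section Trig.
Context {R : realType}.
Implicit Types (t : R) (r : nat).
(** Real and imaginary parts of the character [e(t) = exp(2 i pi t)], which has period 1. *)
Definition cs (t : R) : R := cos (pi *+ 2 * t).
Definition sn (t : R) : R := sin (pi *+ 2 * t).

Lemma cs2Dsn2 t : cs t ^+ 2 + sn t ^+ 2 = 1.
Proof. exact: cos2Dsin2. Qed.
Lemma csB s t : cs (s - t) = cs s * cs t + sn s * sn t.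
Proof. by rewrite /cs mulrBr cosB. Qed.
Lemma csN t : cs (- t) = cs t.
Proof. by rewrite /cs mulrN cosN. Qed.
Lemma csD s t : cs (s + t) = cs s * cs t - sn s * sn t.
Proof. by rewrite /cs mulrDr cosD. Qed.
Lemma snD s t : sn (s + t) = sn s * cs t + cs s * sn t.
Proof. by rewrite /sn mulrDr sinD. Qed.
Lemma csDnat t (n : nat) : cs (t + n%:R) = cs t.
Proof.
rewrite /cs mulrDr mulr_natr.
by have := periodicn (@cosD2pi R) n => ->.
Qed.
Lemma csDint t (m : int) : cs (t + m%:~R) = cs t.
Proof.
case: m => n; first exact: csDnat.
by rewrite NegzE intrN -[LHS](csDnat _ n.+1) subrK.
Qed.

(** Both sides are the squared modulus of the exponential sum of the [e(f i)]; this is the source of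
    all positivity below. *)
Lemma sum_cs_sqr (I : finType) (f : I -> R) :
  \sum_i \sum_j cs (f i - f j) = (\sum_i cs (f i)) ^+ 2 + (\sum_i sn (f i)) ^+ 2.
Proof.
rewrite !expr2 !big_distrlr /= -big_split /=; apply: eq_bigr => i _.
by rewrite -big_split /=; apply: eq_bigr => j _; rewrite csB.
Qed.

(* [dker n t] is [|sum_(i < n) e(i t)|^2] with [e(t) = exp(2 i pi t)]. *)
Definition dker (n : nat) t : R :=
  \sum_(i < n) \sum_(j < n) cs ((i%:R - j%:R) * t).

Lemma dkerE n t : dker n t =
  (\sum_(i < n) cs (i%:R * t)) ^+ 2 + (\sum_(i < n) sn (i%:R * t)) ^+ 2.
Proof.
rewrite -sum_cs_sqr; apply: eq_bigr => i _; apply: eq_bigr => j _.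
by rewrite mulrBl.
Qed.

Lemma dkerDint n t (m : int) : dker n (t + m%:~R) = dker n t.
Proof.
apply: eq_bigr => i _; apply: eq_bigr => j _; rewrite mulrDr.
rewrite (_ : _ * m%:~R = (((i : nat)%:Z - (j : nat)%:Z) * m)%:~R) ?csDint //.
by rewrite intrM intrB.
Qed.

Lemma dker_le n t : dker n t <= n%:R ^+ 2.
Proof.
rewrite (le_trans (y := \sum_(i < n) \sum_(j < n) 1)) //.
  by apply: ler_sum => i _; apply: ler_sum => j _; exact: cos_le1.
by rewrite !sumr_const !card_ord -mulrnA mulnn natrX.
Qed.

(* Multiplying the geometric sum by [1 - e(t)] telescopes. *)
Lemma dker_geom n t : (2 - 2 * cs t) * dker n t <= 4.
Proof.
rewrite dkerE; set X := \sum_(i < n) cs _; set Y := \sum_(i < n) sn _.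
have [h1 h2] : (1 - cs t) * X + sn t * Y = 1 - cs (n%:R * t) /\
    (1 - cs t) * Y - sn t * X = - sn (n%:R * t).
  rewrite /X /Y; elim: n {X Y} => [|n [IH1 IH2]].
    by rewrite !big_ord0 !mul0r /cs /sn !mulr0 cos0 sin0; split; lra.
  rewrite !big_ord_recr /= -[n.+1%:R]natr1 [(_ + 1) * t]mulrDl mul1r csD snD.
  by split; nra.
have := cs2Dsn2 t; have := cs2Dsn2 (n%:R * t).
have : cs (n%:R * t) >= -1 by exact: cos_geN1.
move=> h3 h4 h5.
have -> : (2 - 2 * cs t) * (X ^+ 2 + Y ^+ 2) =
   ((1 - cs t) ^+ 2 + sn t ^+ 2) * (X ^+ 2 + Y ^+ 2).
  by congr (_ * _); rewrite -h5; nra.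
have -> : ((1 - cs t) ^+ 2 + sn t ^+ 2) * (X ^+ 2 + Y ^+ 2) =
  ((1 - cs t) * X + sn t * Y) ^+ 2 + ((1 - cs t) * Y - sn t * X) ^+ 2 by ring.
by rewrite h1 h2; nra.
Qed.

(** The right side is [4 sin(pi t)^2]. For [pi t <= 1] the mean value theorem gives
    [sin(pi t) >= cos 1 * (pi t)]; for larger [pi t], up to [pi/2], the sine is already at least
    [cos 1]. Together with [dker_geom] this yields decay of [dker n t] in [1/t^2]. *)
Lemma one_sub_cs_ge : exists2 c : R, 0 < c &
  forall t, `|t| <= 2^-1 -> c * t ^+ 2 <= 2 - 2 * cs t.
Proof.
have c1 := @cos1_gt0 R; have p2 := @pi_ge2 R; have p4 := @pihalf_lt2 R.
exists (4 * cos 1 ^+ 2) => [|t]; first by rewrite mulr_gt0 // exprn_gt0.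
wlog t0 : t / 0 <= t.
  move=> H; have [t0|t0] := lerP 0 t; first exact: H.
  by rewrite -normrN -[t ^+ 2]sqrrN -(csN t) => ?; apply: H => //; rewrite oppr_ge0 ltW.
rewrite ger0_norm // => t2.
have eq : 2 - 2 * cs t = 4 * sin (pi * t) ^+ 2.
  rewrite /cs (_ : pi *+ 2 * t = (pi * t) *+ 2) ?mulrnAl // cos_mulr2n sin2cos2; lra.
rewrite {}eq -mulrA ler_pM2l // -exprMn ler_sqr ?nnegrE; last 2 first.
- by rewrite mulr_ge0 // ltW.
- by apply: sin_ge0_pi; rewrite mulr_ge0 ?pi_ge0 //=; nra.
have [le1|gt1] := lerP (pi * t) 1; last first.
  have cle : cos 1 <= sin (pi * t).
    have h : pi * t <= pi / 2 by nra.
    rewrite -cosBpihalf -[cos (_ - _)]cosN opprB.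
    case: (ltrgtP (pi / 2 - pi * t) 1) => [lt|gt|->//]; last by nra.
    rewrite le_eqVlt ltr_cos ?lt ?orbT // in_itv /=; apply/andP; split; nra.
  by have := cos_le1 (1 : R); nra.
case: (boolP (t == 0)) => [/eqP ->|tn0]; first by rewrite !mulr0 sin0.
have pt : 0 < pi * t by rewrite mulr_gt0 ?pi_gt0 // lt_neqAle eq_sym tn0.
have [z] : exists2 z, z \in `]0, pi * t[%R &
    sin (pi * t) - sin 0 = cos z * (pi * t - 0).
  apply: MVT => //; apply: continuous_subspaceT => z; exact: continuous_sin.
rewrite in_itv /= sin0 !subr0 => /andP[z0 z1] ->.
have : cos 1 <= cos z.
  by rewrite le_eqVlt ltr_cos ?in_itv /= ?(lt_le_trans z1) ?orbT //; apply/andP; split; lra.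
move=> h; apply: le_trans (ler_wpM2r (ltW pt) h).
by rewrite ler_wpM2l ?(ltW c1) // ler_peMl //; lra.
Qed.

Lemma cs_ge_half : exists2 c : R, 0 < c & forall t, `|t| <= c -> 2^-1 <= cs t.
Proof.
have : continuous cs.
  move=> t; apply: continuous_comp; last exact: continuous_cos.
  by apply: continuousM => //; exact: cst_continuous.
move=> /(_ 0) /cvgrPdist_lt /(_ 2^-1) [] // e /= e0 h.
exists (e / 2) => [|t te]; first by rewrite divr_gt0.
have := h t; rewrite /ball_ /= sub0r normrN => /(_ _).
rewrite {1}/cs mulr0 cos0 => /(_ _); have lt : `|t| < e by lra.
by move=> /(_ lt); rewrite ltr_norml => /andP[_]; lra.
Qed.

End Trig.

(** * Sums of a decaying kernel over separated points *)

Lemma ler_sum_inj (R : numDomainType) (I J : finType) (A : {pred I})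
    (phi : I -> J) (h : J -> R) :
  {in A &, injective phi} -> (forall j, 0 <= h j) ->
  \sum_(i in A) h (phi i) <= \sum_j h j.
Proof.
move=> inj h0; rewrite -(big_imset h inj) /=.
by rewrite [leRHS](bigID [in phi @: A]) /= lerDl sumr_ge0.
Qed.

Lemma sum_inv_sqr_le (R : realFieldType) (B D : R) (J : nat) : 0 <= D ->
  \sum_(i < J.+1) (if i == 0%N :> nat then B else D / i%:R ^+ 2) <= B + 2 * D.
Proof.
move=> D0; case: J => [|n]; first by rewrite big_ord1 /= lerDl mulr_ge0.
(* The bound is strengthened by [1/(n+1)], which telescopes against the new term in the
   induction. *)
suff : \sum_(i < n.+2) (if i == 0%N :> nat then B else D / i%:R ^+ 2) <=
    B + (2 - n.+1%:R^-1) * D.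
  move/le_trans; apply; rewrite lerD2l ler_wpM2r // gerBl.
  by rewrite invr_ge0 ler0n.
elim: n => [|n IH].
  by rewrite !big_ord_recr big_ord0 /= expr1n; lra.
rewrite big_ord_recr /=; apply: le_trans (lerD IH (lexx _)) _.
rewrite -addrA lerD2l [D / _]mulrC -mulrDl ler_wpM2r //.
have p1 : 0 < n.+1%:R :> R by rewrite ltr0n.
have -> : n.+2%:R = n.+1%:R + 1 :> R by rewrite natr1.
move: n.+1%:R p1 => u u0.
rewrite -subr_ge0.
suff -> : 2 - (u + 1)^-1 - (2 - u^-1 + (u + 1) ^- 2) = u^-1 * (u + 1) ^- 2.
  by rewrite mulr_ge0 ?invr_ge0 ?exprn_ge0 //; lra.
by field; rewrite !gt_eqF //; lra.
Qed.

(** Cut the circle, from 0 outwards on both sides, into arcs of length [delta]. Each arc holds at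
    most one point, and on the arc of index [j > 0] the kernel is at most [A / (j delta)^2]. The sum
    over [j] converges, and the outer factor 2 counts the two sides. *)
Lemma sum_separated_le (R : realType) (K : finType) (theta : K -> R)
    (G : R -> R) (delta A B : R) :
  0 < delta -> 0 <= A -> 0 <= B ->
  (forall t (m : int), G (t + m%:~R) = G t) -> (forall t, G t <= B) ->
  (forall t, `|t| <= 2^-1 -> t ^+ 2 * G t <= A) ->
  (forall k k', k != k' -> forall m : int,
     delta <= `|theta k - theta k' - m%:~R|) ->
  \sum_k G (theta k) <= 2 * (B + 2 * (A / delta ^+ 2)).
Proof.
move=> d0 A0 B0 Gper GB GA sep.
(* [t k] is the representative of [theta k] modulo 1 in [[-1/2, 1/2)]. *)
pose m k := Num.floor (theta k + 2^-1).
pose t k := theta k - (m k)%:~R.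
have Gt k : G (theta k) = G (t k) by rewrite /t -intrN Gper.
have tle k : `|t k| <= 2^-1.
  have /andP[h1 h2] := floor_itv (theta k + 2^-1).
  move: h2; rewrite intrD -/(m k) /t ler_norml => h2; rewrite -/(m k) in h1.
  by apply/andP; split; lra.
pose j k := Num.truncn (`|t k| / delta).
have jk k : (j k)%:R * delta <= `|t k| < (j k).+1%:R * delta.
  have h : 0 <= `|t k| / delta by rewrite divr_ge0 // ltW.
  have := truncn_itv h; rewrite -/(j k) => /andP[h1 h2].
  by rewrite -ler_pdivlMr // h1 -ltr_pdivrMr.
pose J := \max_k j k.
have jJ k : (j k < J.+1)%N by rewrite ltnS; exact: (leq_bigmax k).
(* Arc index and side of 0; two points with the same image would be closer than [delta]. *)
pose phi k : 'I_J.+1 * bool := (inord (j k), 0 <= t k).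
pose h (p : 'I_J.+1 * bool) : R :=
  if p.1 == 0%N :> nat then B else A / delta ^+ 2 / p.1%:R ^+ 2.
have inj : injective phi.
  move=> k k' [] /(congr1 val); rewrite /= !inordK // => ejk etk.
  apply/eqP/negPn/negP => kk'.
  have := sep _ _ kk' (m k - m k').
  rewrite intrB (_ : theta k - _ - _ = t k - t k'); last by rewrite /t; lra.
  rewrite leNgt => /negP; apply.
  have := jk k; have := jk k'; rewrite ejk -(natr1 (j k')).
  move: etk; case: (lerP 0 (t k)) => hk; case: (lerP 0 (t k')) => hk' // _.
    rewrite (ger0_norm hk) (ger0_norm hk') => /andP[? ?] /andP[? ?].
    by rewrite ltr_norml; apply/andP; split; lra.
  rewrite (ltr0_norm hk) (ltr0_norm hk') => /andP[? ?] /andP[? ?].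
  by rewrite ltr_norml; apply/andP; split; lra.
have Gh k : G (theta k) <= h (phi k).
  rewrite Gt /h /= inordK //; case: ifPn => // j0.
  have jp : 0 < (j k)%:R * delta by rewrite mulr_gt0 // ltr0n lt0n.
  have /andP[h1 _] := jk k.
  have t2 : ((j k)%:R * delta) ^+ 2 <= t k ^+ 2.
    by rewrite -(real_normK (num_real (t k))) ler_sqr ?nnegrE // ltW.
  rewrite -mulrA -invfM -exprMn [delta * _]mulrC ler_pdivlMr ?exprn_gt0 //.
  have [G0|G0] := lerP (G (t k)) 0.
    by apply: le_trans A0; rewrite mulr_le0_ge0 // exprn_ge0 // ltW.
  by apply: le_trans (GA _ (tle k)); rewrite [leRHS]mulrC ler_wpM2l // ltW.
apply: le_trans (ler_sum _ (fun k _ => Gh k)) _.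
have h0 p : 0 <= h p.
  by rewrite /h; case: ifP => // _; rewrite !divr_ge0 // exprn_ge0 ?ltW.
apply: le_trans (ler_sum_inj (A := predT) (in2W inj) h0) _.
rewrite -(pair_big xpredT xpredT (fun i s => h (i, s))) /= exchange_big /=.
rewrite big_bool /= /h /= -mulr2n -[leLHS]mulr_natl ler_wpM2l //.
by rewrite sum_inv_sqr_le // divr_ge0 // exprn_ge0 // ltW.
Qed.

(** * Counting denominators *)

Definition simult (R : realType) (l : nat) (x : 'rV[R]_l) (a : R) (q : nat) :
  Prop := forall i, exists p : int, `|q%:R * x 0 i - p%:~R| < a.

Definition simult_pred (R : realType) (l : nat) (x : 'rV[R]_l) (a : R) (r : nat) :
  {pred 'I_r.+1} := [pred q : 'I_r.+1 | (0 < q)%N && `[< simult x a q >]].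
Arguments simult_pred {R l} x a r.

Lemma cs_form_ge0 (R : realType) (I : finType) (f : I -> R) :
  0 <= \sum_i \sum_j cs (f i - f j).
Proof. by rewrite sum_cs_sqr addr_ge0 ?sqr_ge0. Qed.

Lemma absz_subn_le (m n N : nat) : (m < N)%N -> (n < N)%N ->
  (absz (m%:Z - n%:Z) <= N)%N.
Proof. lia. Qed.

(** A large sieve. For [k] in the box [[0, N)^l] with [N ~ a0/a], the numbers [P k = <k,x>] are
    [delta]-separated modulo 1. The double sum of [dker] over them is at most of order [#|K| r^2] by
    separation. Expanded the other way it is a sum of squared moduli, in which each counted [q]
    appears at least [r] times with a term at least [#|K|^2 / 2]. Comparing bounds the count by a
    constant times [r / #|K|], and [#|K| = N^l]. *)
Lemma count_approx_le (R : realType) (l : nat) (x : 'rV[R]_l) (tau c : R) :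
  0 <= tau -> 0 < c ->
  (forall n : 'rV[int]_l, n != 0 -> forall m : int,
     c * `|int_vec R n| `^ (- tau) <= `|inner (int_vec R n) x - m%:~R|) ->
  exists C a0 M0 : R, [/\ 0 < C, 0 < a0, 0 < M0 &
    forall (r : nat) (a : R), 0 < a -> a <= a0 -> M0 <= r%:R * a `^ tau ->
      #|simult_pred x a r|%:R <= C * (r%:R * a ^+ l)].
Proof.
move=> tau0 c0 hx.
have [eta eta0 hcs] := @cs_ge_half R; have [c' c'0 hker] := @one_sub_cs_ge R.
have lp : 0 < l.+1%:R :> R by rewrite ltr0n.
(* With [N a <= a0], the errors of the [l] coordinates add up to at most [eta], the range where the
   cosine is at least [1/2]. *)
pose a0 := eta / l.+1%:R.
have a00 : 0 < a0 by rewrite divr_gt0.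
(* From [sum_separated_le] with [B = 9 r^2] (as [2r+1 <= 3r]), [A = 4/c'] and [1/delta <= r]. *)
pose C3 : R := 2 * (9 + 2 * (4 / c')).
have C30 : 0 < C3 by rewrite mulr_gt0 // addr_gt0 // mulr_gt0 // divr_gt0.
exists (2 * C3 * (2 / a0) ^+ l), a0, (a0 `^ tau / c); split => //.
- by apply: mulr_gt0; [exact: mulr_gt0 | rewrite exprn_gt0 // divr_gt0].
- by rewrite divr_gt0 // powR_gt0.
move=> r a a_gt0 aa0 hr.
have at0 : 0 < a `^ tau by rewrite powR_gt0.
have a0t0 : 0 < a0 `^ tau by rewrite powR_gt0.
have r0 : (0 < r%:R :> R).
  have : 0 < r%:R * a `^ tau by apply: lt_le_trans hr; rewrite divr_gt0.
  by rewrite pmulr_lgt0.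
pose N := Num.truncn (a0 / a).
have v1 : 1 <= a0 / a by rewrite ler_pdivlMr ?mul1r.
have v0 : 0 <= a0 / a by lra.
have /andP[Nle Nlt] := truncn_itv v0; rewrite -/N in Nle Nlt.
have N0 : (0 < N)%N by rewrite truncn_gt0.
have N0R : 0 < N%:R :> R by rewrite ltr0n.
have N1R : 1 <= N%:R :> R by rewrite ler1n.
(* The hypothesis on [x] for vectors of norm at most [a0/a]. The choice of [M0] means exactly
   [r delta >= 1]. *)
pose delta := c * (a `^ tau / a0 `^ tau).
have delta0 : 0 < delta by rewrite mulr_gt0 // divr_gt0.
have rdelta : 1 <= r%:R * delta.
  move: hr; rewrite ler_pdivrMr // /delta => hr.
  have -> : r%:R * (c * (a `^ tau / a0 `^ tau)) =
    r%:R * a `^ tau * c / a0 `^ tau by ring.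
  by rewrite ler_pdivlMr // mul1r.
pose K := {ffun 'I_l -> 'I_N}.
pose P (k : K) : R := \sum_i (k i)%:R * x 0 i.
have sep k k' : k != k' -> forall m : int, delta <= `|P k - P k' - m%:~R|.
  move=> kk' m; pose n : 'rV[int]_l := \row_i ((k i : nat)%:Z - (k' i : nat)%:Z).
  have nn0 : n != 0.
    apply: contra kk' => /eqP/rowP h; apply/eqP/ffunP => i; apply/val_inj.
    by have := h i; rewrite !mxE => /eqP; rewrite subr_eq0 => /eqP[].
  have -> : P k - P k' = inner (int_vec R n) x.
    rewrite /P /inner -sumrB; apply: eq_bigr => i _.
    by rewrite !mxE intrB mulrBl.
  apply: le_trans (hx n nn0 m); rewrite /delta ler_pM2l //.
  have [i [ni0 nE _]] := int_vec_norm_nat R nn0.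
  have nle : `|int_vec R n| <= a0 / a.
    rewrite nE (le_trans _ Nle) // ler_nat mxE.
    exact: absz_subn_le.
  have nge0 : 0 < `|int_vec R n| by rewrite nE ltr0n.
  rewrite powRN ler_pdivrMr // ler_pdivlMl ?powR_gt0 //.
  rewrite -powRM; [|exact: ltW|exact: ltW].
  rewrite ler_pdivlMr // in nle.
  by apply: ge0_ler_powR; rewrite ?nnegrE // ?mulr_ge0 //; exact: ltW.
(* Room for all the indices [j + q] with [j < r] and [q <= r]. *)
pose n := (r + r)%N.
have upper : \sum_k \sum_k' dker n.+1 (P k - P k') <= #|K|%:R * (C3 * r%:R ^+ 2).
  rewrite mulr_natl -sumr_const; apply: ler_sum => k _.
  have S := @sum_separated_le R K (fun k' => P k - P k') (dker n.+1) delta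
    (4 / c') (9 * r%:R ^+ 2) delta0.
  apply: le_trans (S _ _ _ _ _ _) _; first by rewrite divr_ge0 // ltW.
  - by rewrite mulr_ge0 // exprn_ge0.
  - by move=> t m; exact: dkerDint.
  - move=> t; apply: le_trans (dker_le _ _) _.
    rewrite /n -natr1 natrD; have : 1 <= r%:R :> R by rewrite ler1n -(ltr0n R).
    by nra.
  - move=> t /hker ht; rewrite ler_pdivlMr // mulrC mulrA.
    apply: le_trans (dker_geom n.+1 t); apply: ler_wpM2r => //.
    by rewrite dkerE addr_ge0 ?sqr_ge0.
  - move=> k1 k2 k12 m; rewrite (_ : _ - _ = P k2 - P k1 - m%:~R); last by lra.
    by apply: sep; rewrite eq_sym.
  have dr : delta ^- 2 <= r%:R ^+ 2.
    rewrite -exprVn ler_sqr ?nnegrE ?invr_ge0 //; last exact: ltW.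
    by rewrite -div1r ler_pdivrMr.
  have : 4 / c' * delta ^- 2 <= 4 / c' * r%:R ^+ 2 by rewrite ler_pM2l ?divr_gt0.
  by rewrite /C3; lra.
(* Each [q] in the counted set occurs as a difference of [r] pairs, for which all the
   phases are close to integers. *)
have lower : r%:R * (#|simult_pred x a r|%:R * (2^-1 * #|K|%:R ^+ 2)) <=
    \sum_k \sum_k' dker n.+1 (P k - P k').
  (* [W i j] is the squared modulus of the sum over [k] of [e((i - j) P k)]. Being nonnegative, it
     may be dropped except at the pairs [(j + q, j)]. *)
  pose W (i j : 'I_n.+1) := \sum_k \sum_k' cs ((i%:R - j%:R) * P k - (i%:R - j%:R) * P k').
  have -> : \sum_k \sum_k' dker n.+1 (P k - P k') = \sum_(j < n.+1) \sum_(i < n.+1) W i j.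
    rewrite /dker /W; under eq_bigr do rewrite exchange_big /=.
    rewrite exchange_big /= [RHS]exchange_big; apply: eq_bigr => i _ /=.
    under eq_bigr do rewrite exchange_big /=.
    rewrite exchange_big /=; apply: eq_bigr => j _.
    by apply: eq_bigr => k _; apply: eq_bigr => k' _; rewrite mulrBr.
  have W0 i j : 0 <= W i j by exact: cs_form_ge0.
  pose low (j : 'I_r) : 'I_n.+1 := inord j.
  have lowE j : low j = j :> nat.
    by rewrite /low inordK // ltnS (leq_trans (ltnW (ltn_ord j))) ?leq_addr.
  apply: le_trans (ler_sum_inj (A := predT) (phi := low)
    (h := fun j => \sum_(i < n.+1) W i j) _ _); last 2 first.
  - by move=> j j' _ _ /(congr1 val) /=; rewrite !lowE => /val_inj.
  - by move=> j; exact: sumr_ge0.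
  rewrite -[X in X%:R * _](card_ord r) mulr_natl -sumr_const; apply: ler_sum => j _.
  pose sh (q : 'I_r.+1) : 'I_n.+1 := inord (j + q).
  have shE q : sh q = (j + q)%N :> nat.
    apply: inordK; rewrite ltnS; apply: leq_add; first exact: ltnW.
    by rewrite -ltnS.
  apply: le_trans (ler_sum_inj (A := simult_pred x a r) (phi := sh)
    (h := fun i => W i (low j)) _ _); last 2 first.
  - by move=> q q' _ _ /(congr1 val); rewrite /= !shE => /addnI /val_inj.
  - by [].
  rewrite mulr_natl -sumr_const; apply: ler_sum => q.
  rewrite inE => /andP[_ /asboolP /fin_all_exists[p hp]].
  rewrite /W shE lowE.
  have -> : (j + q)%:R - (j : nat)%:R = q%:R :> R by rewrite natrD; lra.
  rewrite expr2 [2^-1 * _]mulrC -mulrA mulr_natl -sumr_const.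
  apply: ler_sum => k _; rewrite mulr_natl -sumr_const; apply: ler_sum => k' _.
  rewrite -mulrBr /P -sumrB.
  (* The integer near [q (P k - P k')] obtained by combining the approximations of the [q x_i]. *)
  pose m : int := \sum_i ((k i : nat)%:Z - (k' i : nat)%:Z) * p i.
  rewrite -(subrK m%:~R (_ * _)) csDint; apply: hcs.
  rewrite /m rmorph_sum /= mulr_sumr -sumrB.
  apply: le_trans (ler_norm_sum _ _ _) _.
  apply: le_trans (ler_sum (G := fun=> N%:R * a) _ _) _.
    move=> i _; rewrite intrM intrB -mulrBl mulrCA -mulrBr normrM.
    apply: ler_pM => //; last exact: ltW (hp i).
    have := ltn_ord (k i); have := ltn_ord (k' i) => h1 h2.
    have : (k i)%:R <= N%:R :> R by rewrite ler_nat ltnW.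
    have : (k' i)%:R <= N%:R :> R by rewrite ler_nat ltnW.
    have : 0 <= (k i)%:R :> R by []. have : 0 <= (k' i)%:R :> R by [].
    by move=> ? ? ? ?; rewrite ler_norml; apply/andP; split; lra.
  rewrite sumr_const card_ord.
  have NA : N%:R * a <= a0 by rewrite -ler_pdivlMr.
  rewrite -[leLHS]mulr_natl; apply: le_trans (ler_wpM2l _ NA) _ => //.
  by rewrite /a0 mulrCA ger_pMr // ler_pdivrMr // mul1r ler_nat.
have KE : #|K|%:R = N%:R ^+ l :> R by rewrite card_ffun !card_ord natrX.
have K0 : 0 < #|K|%:R :> R by rewrite KE exprn_gt0.
have := le_trans lower upper.
have -> : r%:R * (#|simult_pred x a r|%:R * (2^-1 * #|K|%:R ^+ 2)) =
  (#|simult_pred x a r|%:R * #|K|%:R) * (2^-1 * #|K|%:R * r%:R) :> R by ring.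
have -> : #|K|%:R * (C3 * r%:R ^+ 2) =
  (2 * C3 * r%:R) * (2^-1 * #|K|%:R * r%:R) :> R by field.
rewrite ler_pM2r; last by rewrite !mulr_gt0 // invr_gt0.
rewrite -ler_pdivlMr // => /le_trans; apply.
have -> : 2 * C3 * (2 / a0) ^+ l * (r%:R * a ^+ l) =
    2 * C3 * r%:R * (2 * a / a0) ^+ l by rewrite !exprMn; ring.
rewrite ler_pM2l; last by rewrite mulr_gt0 // mulr_gt0.
rewrite KE -exprVn; apply: lerXn2r.
- by rewrite nnegrE invr_ge0 ltW.
- by rewrite nnegrE divr_ge0 ?mulr_ge0 ?ltW.
rewrite -div1r ler_pdivrMr // mulrAC ler_pdivlMr // mul1r.
by move: Nlt; rewrite -natr1 ltr_pdivrMr //; nra.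
Qed.

(** * From the dual type to a uniform lower bound on linear forms *)

Lemma finite_int_vec_bounded (R : realType) (l : nat) (E : set 'rV[int]_l) :
  finite_set E -> exists W : nat, forall n, E n -> `|int_vec R n| < W%:R.
Proof.
move=> /finite_seqP[s ->].
exists (\max_(n <- s) (Num.truncn `|int_vec R n|).+1)%N => n /= ns.
have /andP[_ /lt_le_trans] := truncn_itv (normr_ge0 (int_vec R n)); apply.
by rewrite ler_nat (leq_bigmax_seq (F := fun n => (Num.truncn `|int_vec R n|).+1)).
Qed.

(** An exponent [tau] strictly between the type and [d] leaves only finitely many exceptional [n],
    which the constant [c] absorbs. The parameter [t0] allows [tau] to be taken at least [l]
    later. *)
Lemma dual_type_lt_lower_bound (R : realType) (l : nat) (x : 'rV[R]_l) (t0 d : R) :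
  0 <= t0 -> t0 < d -> (dual_type x < d%:E)%E ->
  exists tau c : R, [/\ t0 <= tau, tau < d, 0 < c &
    forall n : 'rV[int]_l, n != 0 -> forall m : int,
      c * `|int_vec R n| `^ (- tau) <= `|inner (int_vec R n) x - m%:~R|].
Proof.
move=> t00 t0d xd.
have [tau [tau0 taud xtau]] : exists tau, [/\ t0 < tau, tau < d & (dual_type x < tau%:E)%E].
  (* The last case is the type [-oo], the supremum of the empty set. *)
  case: (dual_type x) xd => [t|//|_]; last by exists ((t0 + d) / 2); split; rewrite ?ltNyr; lra.
  rewrite lte_fin => td; exists ((Num.max t t0 + d) / 2); split; rewrite ?lte_fin;
    by case: (leP t t0); lra.
(* Multiplying [n] by a large [W] takes it out of the finite exceptional set [E]. *)
pose E := [set n : 'rV[int]_l | n != 0 /\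
  dist_int (inner (int_vec R n) x) < `|int_vec R n| `^ (- tau)].
have finE : finite_set E.
  apply: contrapT => infE; move: xtau; rewrite ltNge => /negP; apply.
  apply: ereal_sup_ubound; exists tau => //=; split=> //; lra.
have [W0 hW0] := finite_int_vec_bounded R finE.
pose W := W0.+1; have W1 : 0 < W%:R :> R by rewrite ltr0n.
(* One factor [W^(-tau)] comes from [|W n|^(-tau)], the other [1/W] from dividing [W <n,x> - W m] by
   [W]. *)
exists tau, (W%:R `^ (- tau) / W%:R); split => //; first exact: ltW.
  by rewrite divr_gt0 // powR_gt0.
move=> n n0 m.
have [i [ni0 nE _]] := int_vec_norm_nat R n0.
have WnE : int_vec R (n *+ W) = W%:R *: int_vec R n.
  by apply/rowP => j; rewrite !mxE mulmxnE rmorphMn /= mulr_natl.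
have WnN : `|int_vec R (n *+ W)| = W%:R * `|int_vec R n|.
  by rewrite WnE normrZ ger0_norm.
have Wn0 : n *+ W != 0.
  apply/eqP => h; have : `|int_vec R (n *+ W)| = 0.
    by rewrite h; apply/eqP; rewrite normr_eq0; apply/eqP/rowP => j; rewrite !mxE.
  by rewrite WnN nE => /eqP; rewrite -natrM pnatr_eq0 muln_eq0 /= gtn_eqF.
have nin : ~ E (n *+ W).
  move=> /hW0; rewrite WnN nE -natrM ltr_nat ltnNge => /negP; apply.
  by rewrite (leq_trans (leqnSn W0)) // leq_pmulr.
have : `|int_vec R (n *+ W)| `^ (- tau) <= dist_int (inner (int_vec R (n *+ W)) x).
  by rewrite leNgt; apply/negP => h; apply: nin.
rewrite WnN powRM // => h.
rewrite mulrAC ler_pdivrMr //; apply: le_trans h _.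
apply: le_trans (dist_int_le _ (m * W%:Z)) _.
rewrite -[X in _ <= _ * X](ger0_norm (ltW W1)) -normrM mulrBl intrM.
suff -> : inner (int_vec R (n *+ W)) x = inner (int_vec R n) x * W%:R by [].
by rewrite /inner mulr_suml; apply: eq_bigr => j _; rewrite WnE !mxE; ring.
Qed.

(** * Dirichlet's theorem *)

Lemma dirichlet (R : realType) (l : nat) (x : 'rV[R]_l) (y : R) (M L Q : nat) :
  (M.+1 ^ l * L.+1 <= Q)%N -> exists q, [/\ (0 < q)%N, (q <= Q)%N,
    simult x M.+1%:R^-1 q & exists p : int, `|q%:R * y - p%:~R| < L.+1%:R^-1].
Proof.
move=> hQ.
pose f (q : nat) := ([ffun i : 'I_l => cell M (q%:R * x 0 i)], cell L (q%:R * y)).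
have [|i [j [ij jQ [fij gij]]]] := @pigeonhole_leq _ Q f.
  by rewrite card_prod card_ffun !card_ord.
exists (j - i)%N; split; first by rewrite subn_gt0.
- by rewrite (leq_trans (leq_subr _ _)).
- move=> k; apply: cell_approx; first exact: ltnW.
  by have /ffunP/(_ k) := fij; rewrite !ffunE.
- by apply: cell_approx gij; exact: ltnW.
Qed.

(** The integral version with [M+1] between [1/a] and [2/a], and [L] the integer part of
    [Q / (M+1)^l]. Rounding costs a factor 2 for each coordinate of [x] and one more for [y], hence
    [2^(l+1)]. *)
Lemma dirichlet_real (R : realType) (l : nat) (x : 'rV[R]_l) (y a : R) (Q : nat) :
  0 < a -> a <= 1 -> 2 ^+ l <= Q%:R * a ^+ l -> exists q, [/\ (0 < q)%N, (q <= Q)%N,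
    simult x a q & exists p : int, `|q%:R * y - p%:~R| < 2 ^+ l.+1 / (Q%:R * a ^+ l)].
Proof.
move=> a0 a1 hQ.
have al0 : 0 < a ^+ l by rewrite exprn_gt0.
have Q0 : 0 < Q%:R :> R.
  by rewrite -(pmulr_lgt0 _ al0); apply: lt_le_trans hQ; rewrite exprn_gt0.
have v1 : 1 <= a^-1 by rewrite invf_ge1.
have v0 : 0 <= a^-1 by lra.
have /andP[M1 M2] := truncn_itv v0; set M := Num.truncn _ in M1 M2.
have M0 : 0 < M.+1%:R :> R by rewrite ltr0n.
have Ml0 : 0 < M.+1%:R ^+ l :> R by rewrite exprn_gt0.
have M3 : M.+1%:R <= 2 / a by rewrite -natr1; lra.
have Ml : M.+1%:R ^+ l <= 2 ^+ l / a ^+ l.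
  by rewrite -expr_div_n lerXn2r ?nnegrE // divr_ge0 // ltW.
have t1 : (1 : R) <= Q%:R / M.+1%:R ^+ l.
  rewrite ler_pdivlMr // mul1r (le_trans Ml) // ler_pdivrMr //.
have t0 : (0 : R) <= Q%:R / M.+1%:R ^+ l by lra.
have /andP[L1 L2] := truncn_itv t0; set L := Num.truncn _ in L1 L2.
have L0 : (0 < L)%N by rewrite truncn_gt0.
(* The integral version takes [L-1], since it uses one box more than its parameter. *)
move: L1 L2; rewrite -(prednK L0) => L1 L2.
have [|q [q0 qQ qx [p qp]]] := @dirichlet R l x y M L.-1 Q.
  by rewrite -(ler_nat R) natrM natrX mulrC -ler_pdivlMr.
exists q; split=> //.
  move=> i; have [p' hp'] := qx i; exists p'; apply: lt_trans hp' _.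
  by rewrite -[ltRHS]invrK ltf_pV2 ?posrE ?invr_gt0.
exists p; apply: lt_le_trans qp _.
rewrite -div1r ler_pdivrMr ?ltr0n // mulrAC ler_pdivlMr ?mulr_gt0 // mul1r exprS -mulrA.
have h1 : (1 : R) <= L.-1.+1%:R by rewrite ler1n.
move: L2; rewrite ltr_pdivrMr // -natr1 => L2.
have h2 : Q%:R <= 2 * L.-1.+1%:R * M.+1%:R ^+ l :> R.
  apply: ltW; apply: lt_le_trans L2 _; rewrite ler_pM2r //; lra.
move: Ml; rewrite ler_pdivlMr // => Ml.
apply: le_trans (ler_wpM2r (ltW al0) h2) _.
have := ler_wpM2l (le_trans ler01 h1) Ml; lra.
Qed.

(** Cut the interval [[z - t, z + t]] from its left end into cells of length [h]: each contains at
    most one of the points. *)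
Lemma card_separated_le (R : realType) (I : finType) (A : {pred I}) (f : I -> R)
    (h z t : R) : 0 < h -> 0 <= t ->
  {in A &, forall i j, i != j -> h <= `|f i - f j|} ->
  {in A, forall i, `|f i - z| <= t} -> #|A|%:R <= 2 * t / h + 1.
Proof.
move=> h0 t0 sep near; set N := Num.truncn (2 * t / h).
have v0 : 0 <= 2 * t / h by rewrite divr_ge0 ?mulr_ge0 // ltW.
pose g i := Num.truncn ((f i - z + t) / h).
have w0 i : i \in A -> 0 <= (f i - z + t) / h.
  by move=> /near; rewrite ler_norml => /andP[? ?]; apply: divr_ge0; [lra|exact: ltW].
have gN i : i \in A -> (g i < N.+1)%N.
  move=> iA; rewrite ltnS le_truncn // ler_pM2r ?invr_gt0 //.
  by have := near _ iA; rewrite ler_norml => /andP[? ?]; lra.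
have inj : {in A &, injective (fun i => inord (g i) : 'I_N.+1)}.
  move=> i j iA jA /(congr1 val); rewrite /= !inordK ?gN // => gij.
  apply/eqP/negPn/negP => /(sep _ _ iA jA).
  have := truncn_itv (w0 _ iA); have := truncn_itv (w0 _ jA).
  rewrite -/(g i) -/(g j) gij -natr1 => /andP[a1 a2] /andP[b1 b2].
  rewrite leNgt => /negP; apply.
  move: a1 a2 b1 b2; rewrite !ler_pdivlMr // !ltr_pdivrMr // => a1 a2 b1 b2.
  by rewrite ltr_norml; apply/andP; split; lra.
have : (#|A| <= N.+1)%N.
  by rewrite -(card_in_image inj) -[leqRHS]card_ord max_card.
rewrite -(ler_nat R) -natr1 => /le_trans; apply; rewrite lerD2r.
by rewrite truncn_le.
Qed.

Lemma card_fibers_le (R : realType) (I K : finType) (A : {pred I}) (P : {pred K})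
    (g : I -> K) (b : R) : {in A, forall i, g i \in P} ->
  {in P, forall k, #|[pred i in A | g i == k]|%:R <= b} ->
  #|A|%:R <= #|P|%:R * b.
Proof.
move=> gP hb; rewrite -sum1_card (partition_big g (mem P)) //= natr_sum.
rewrite mulr_natl -sumr_const; apply: ler_sum => k kP.
by rewrite sum1_card; apply: hb.
Qed.

(** * Local ubiquity of rational points *)

(** Midpoints of [n] equal parts of []u, u + w[]: a perturbation by up to half the mesh stays
    inside. *)
Definition grid (R : realType) (u w : R) (n : nat) (j : nat) : R :=
  u + (j%:R + 2^-1) * (w / n%:R).

Lemma grid_separated (R : realType) (u w : R) (n i j : nat) :
  0 <= w -> i != j -> w / n%:R <= `|grid u w n i - grid u w n j|.
Proof.
move=> w0 ij; have h0 : 0 <= w / n%:R by rewrite divr_ge0.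
rewrite /grid (_ : _ - _ = (i%:R - j%:R) * (w / n%:R)); last by ring.
rewrite normrM (ger0_norm h0) ler_peMl //.
wlog lt : i j ij / (i < j)%N.
  move=> H; case: (ltngtP i j) => [|ji|/eqP]; [exact: H| |by rewrite (negPf ij)].
  by rewrite distrC; apply: H => //; rewrite eq_sym.
rewrite distrC ger0_norm ?subr_ge0 ?ler_nat 1?ltnW //.
by rewrite lerBrDl natr1 ler_nat.
Qed.

Lemma grid_itv (R : realType) (u w : R) (n : nat) (j : 'I_n) : 0 < w ->
  u < grid u w n j < u + w.
Proof.
move=> w0; have n0 : 0 < n%:R :> R by rewrite ltr0n (leq_trans _ (ltn_ord j)).
have h0 : 0 < w / n%:R by rewrite divr_gt0.
have jn : j%:R + 1 <= n%:R :> R by rewrite natr1 ler_nat.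
have j0 : 0 <= j%:R :> R by [].
have p0 : 0 < (j%:R + 2^-1) * (w / n%:R) by apply: mulr_gt0 => //; lra.
have p1 : (j%:R + 2^-1) * (w / n%:R) < w.
  by rewrite mulrA ltr_pdivrMr // mulrC ltr_pM2l //; lra.
by rewrite /grid; apply/andP; split; lra.
Qed.

(** At most [2 q w] numerators [p] occur, [q w >= 4] absorbing the boundary terms. Around each [p/q]
    the mesh [w/n] leaves at most [2 (rho/q) / (w/n) + 1] grid points. *)
Lemma card_near_rational (R : realType) (n : nat) (u w rho : R) (q : nat)
    (A : {pred 'I_n}) (pp : 'I_n -> int) :
  0 < w -> 0 < rho -> rho <= 1 -> 4 <= q%:R * w ->
  {in A, forall j : 'I_n, `|q%:R * grid u w n j - (pp j)%:~R| < rho} ->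
  #|A|%:R <= 4 * rho * n%:R + 2 * (q%:R * w).
Proof.
move=> w0 rho0 rho1 qw near.
case: n A pp near => [|n'] A pp near.
  rewrite eq_card0; last by case.
  by rewrite mulr0 add0r; lra.
set n := n'.+1 in A pp near *.
have n0 : 0 < n%:R :> R by rewrite ltr0n.
have q0 : 0 < q%:R :> R by rewrite -(pmulr_lgt0 _ w0); lra.
have h0 : 0 < w / n%:R by rewrite divr_gt0.
pose F := Num.floor (q%:R * u).
have Fitv : F%:~R <= q%:R * u < F%:~R + 1.
  by have := floor_itv (q%:R * u); rewrite intrD.
pose K := (Num.truncn (q%:R * w + 3)).+1.
pose k j := absz (pp j - F + 1).
have kE j : j \in A -> pp j = (k j)%:Z + F - 1.
  move=> /near; have /andP[g1 g2] := grid_itv u j w0.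
  rewrite ltr_norml => /andP[h1 h2]; have /andP[F1 F2] := Fitv.
  rewrite /k gez0_abs; first by ring.
  have g3 : q%:R * u < q%:R * grid u w n j by rewrite ltr_pM2l.
  have : (- 1)%:~R < (pp j - F + 1)%:~R :> R by rewrite !rmorphD !rmorphN /=; lra.
  by rewrite ltr_int; move: (pp j - F + 1) => z; clear; lia.
have kK j : j \in A -> (k j < K)%N.
  move=> jA; have /andP[g1 g2] := grid_itv u j w0.
  have := near _ jA; rewrite (kE _ jA).
  rewrite ltr_norml => /andP[h1 h2]; have /andP[F1 F2] := Fitv.
  have g3 : q%:R * grid u w n j < q%:R * (u + w) by rewrite ltr_pM2l.
  rewrite ltnS truncn_ge_nat; last by lra.
  move: h1 h2; rewrite !rmorphD !rmorphN /= => h1 h2.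
  rewrite (_ : (k j)%:R = (k j)%:~R) //; lra.
have KR : K%:R <= 2 * (q%:R * w).
  have v0 : 0 <= q%:R * w + 3 by lra.
  have /andP[h1 _] := truncn_itv v0.
  by rewrite /K -natr1; lra.
have fib := @card_fibers_le R _ _ A predT (fun j => inord (k j) : 'I_K)
   (2 * (rho / q%:R) / (w / n%:R) + 1).
apply: le_trans (fib _ _) _ => //.
  move=> i _; apply: (@card_separated_le _ _ _ (fun j => grid u w n (val j)) (w / n%:R)
     (((i : nat)%:~R + F%:~R - 1) / q%:R) (rho / q%:R)) => //.
  - by rewrite divr_ge0 // ltW.
  - move=> j j' _ _ jj'; apply: grid_separated; [exact: ltW|exact: jj'].
  - move=> j; rewrite inE => /andP[jA /eqP/(congr1 val)]; rewrite /= inordK ?kK // => kj.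
    rewrite -(ler_pM2l q0) -[X in X * _ <= _](ger0_norm (ltW q0)) -normrM mulrBr.
    rewrite !(mulrCA q%:R _ q%:R^-1) mulfV ?gt_eqF // !mulr1.
    have := ltW (near _ jA); rewrite (kE _ jA) kj.
    by rewrite !rmorphD !rmorphN /=.
rewrite card_ord; apply: le_trans (ler_wpM2r _ KR) _.
  by rewrite addr_ge0 // !mulr_ge0 ?invr_ge0 // ltW // mulr_gt0 ?invr_gt0 //.
rewrite mulrDr mulr1 lerD2r le_eqVlt; apply/orP; left; apply/eqP.
by field; rewrite !gt_eqF.
Qed.

(** The lower bound on linear forms, applied to [q] times a basis vector: a small [a] forces every
    admissible [q] to be large. *)
Lemma simult_lower_bound (R : realType) (l : nat) (x : 'rV[R]_l) (tau c a : R)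
    (q : nat) : (0 < l)%N ->
  (forall n : 'rV[int]_l, n != 0 -> forall m : int,
     c * `|int_vec R n| `^ (- tau) <= `|inner (int_vec R n) x - m%:~R|) ->
  (0 < q)%N -> simult x a q -> c * q%:R `^ (- tau) < a.
Proof.
move=> l0 hx q0 qx; have [p hp] := qx (Ordinal l0).
pose n : 'rV[int]_l := \row_i (if i == Ordinal l0 then q%:Z else 0).
have n0 : n != 0.
  apply/eqP => /rowP/(_ (Ordinal l0)); rewrite !mxE eqxx => -[] /eqP.
  by rewrite gtn_eqF.
have [i [ni0 nE _]] := int_vec_norm_nat R n0.
have : n 0 i = q by move: ni0; rewrite mxE; case: eqP.
move=> niq; move: nE; rewrite niq /= => nE.
have := hx n n0 p; rewrite nE.
suff -> : inner (int_vec R n) x = q%:R * x 0 (Ordinal l0).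
  by move/le_lt_trans; apply.
rewrite /inner (bigD1 (Ordinal l0)) //= !mxE eqxx big1 ?addr0 // => j jl.
by rewrite !mxE (negPf jl) mul0r.
Qed.

(** Dirichlet's theorem at each grid point gives [q <= D r] with error [rho]. If [q > r], the
    fraction is within [s = rho/r] of the grid point. The grid points served by some [q <= r] are at
    most half: [count_approx_le] bounds the number of such [q], and [card_near_rational] the grid
    points near each. [D0] and [C] do not depend on the interval, so the final proportion does not
    either. *)
Lemma local_ubiquity (R : realType) (l : nat) (x : 'rV[R]_l) (tau c : R) :
  (0 < l)%N -> l%:R <= tau -> 0 < c ->
  (forall n : 'rV[int]_l, n != 0 -> forall m : int,
     c * `|int_vec R n| `^ (- tau) <= `|inner (int_vec R n) x - m%:~R|) ->
  exists (D0 : nat) (C : R), 1 <= C /\ forall D : nat, (D0 <= D)%N ->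
  forall w : R, 0 < w -> exists M a1 : R, [/\ 0 < M, 0 < a1 &
  forall (r : nat) (a u : R), 0 < a -> a <= a1 -> M <= (D * r)%:R * a `^ tau ->
  exists (n : nat) (J : {pred 'I_n}) (ctr : 'I_n -> R),
    let s := C / ((D * r)%:R * a ^+ l) / r%:R in
    [/\ (0 < n)%N, (n <= 2 * #|J|)%N, 3 * s <= w / n%:R <= 6 * s &
      {in J, forall j : 'I_n, `|ctr j - grid u w n j| < s /\
        exists (q : nat) (p : int), [/\ (r < q)%N, (q <= D * r)%N, simult x a q &
          q%:R * ctr j = p%:~R]}]].
Proof.
move=> l0 ltau c0 hx.
have tau0 : 0 <= tau by apply: le_trans ltau.
have [C2 [a0 [M0 [C20 a00 M00 hcount]]]] := count_approx_le tau0 c0 hx.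
pose C1 : R := 2 ^+ l.+1.
have C11 : 1 <= C1 by apply: exprn_ege1; rewrite ler1n.
(* The bad grid points contribute [4 C1 C2 n / D] from the radius and at most [12 C1 C2 n / D] from
   the number of numerators, so [D >= 32 C1 C2] bounds them by [n/2]. *)
pose D0 := (Num.truncn (32 * C1 * C2)).+1.
exists D0, C1; split => // D D0D w w0.
have DR : 32 * C1 * C2 <= D%:R.
  have v0 : 0 <= 32 * C1 * C2 by rewrite !mulr_ge0 //; lra.
  have /andP[_ /ltW h] := truncn_itv v0; apply: le_trans h _.
  by rewrite ler_nat.
have Dnat : (0 < D)%N by apply: leq_trans D0D.
have Dp : 0 < D%:R :> R by rewrite ltr0n.
(* The terms serve respectively the counting bound at [r], the bound [rho <= 1], and [3 s <= w]. *)
pose M := D%:R * M0 + C1 + 3 * C1 / w.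
have C1w : 0 < 3 * C1 / w by rewrite divr_gt0 //; lra.
have DM0 : 0 < D%:R * M0 by rewrite mulr_gt0.
have wt0 : 0 < (4 / w) `^ (- tau) by rewrite powR_gt0 // divr_gt0.
(* The last term forces [q w >= 4] through [simult_lower_bound]. *)
pose a1 := Num.min (Num.min 1 a0) (c * (4 / w) `^ (- tau)).
have M_gt0 : 0 < M by rewrite /M; lra.
exists M, a1; split => //; first by rewrite !lt_min ltr01 a00 mulr_gt0.
move=> r a u a_gt0; rewrite /a1 !le_min => /andP[/andP[a_le1 aa0] aw] MQ.
set Q := (D * r)%N in MQ *.
have at0 : 0 < a `^ tau by rewrite powR_gt0.
have al0 : 0 < a ^+ l by rewrite exprn_gt0.
have ataul : a `^ tau <= a ^+ l.
  rewrite -powR_mulrn; last exact: ltW.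
  by apply: ger_powR; rewrite ?a_gt0.
have Q0 : 0 < Q%:R :> R by rewrite -(pmulr_lgt0 _ at0); apply: lt_le_trans MQ.
have r0 : 0 < r%:R :> R.
  by move: Q0; rewrite /Q natrM pmulr_rgt0.
have r1 : 1 <= r%:R :> R by rewrite ler1n -(ltr0n R).
have QE : Q%:R = D%:R * r%:R :> R by rewrite natrM.
(* Here [l <= tau] enters: as [a <= 1], a bound on [Q a^tau] from below is one on [Q a^l]. *)
have Ql : M <= Q%:R * a ^+ l by apply: le_trans MQ _; rewrite ler_pM2l.
have Ql0 : 0 < Q%:R * a ^+ l by rewrite mulr_gt0.
set rho := C1 / (Q%:R * a ^+ l).
have rho0 : 0 < rho by rewrite divr_gt0 //; lra.
have rho1 : rho <= 1 by rewrite ler_pdivrMr // mul1r (le_trans _ Ql) // /M; lra.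
set s := rho / r%:R.
have s0 : 0 < s by rewrite divr_gt0.
have sw : 3 * s <= w.
  have : s <= rho by rewrite ler_pdivrMr // ler_peMr // ltW.
  suff : 3 * rho <= w by lra.
  rewrite /rho mulrA ler_pdivrMr // [leRHS]mulrC -ler_pdivrMr // (le_trans _ Ql) // /M.
  by move: C1w; rewrite /M; lra.
(* The integer part of a number at least 1 is at least half of it, so the mesh lies between [3 s]
   and [6 s]. *)
pose n := Num.truncn (w / (3 * s)).
have s30 : 0 < 3 * s by lra.
have v1 : 1 <= w / (3 * s) by rewrite ler_pdivlMr // mul1r.
have v0 : 0 <= w / (3 * s) by lra.
have /andP[n1 n2] := truncn_itv v0; rewrite -/n in n1 n2.
have n0 : (0 < n)%N by rewrite truncn_gt0.
have n0R : 0 < n%:R :> R by rewrite ltr0n.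
have n1R : 1 <= n%:R :> R by rewrite ler1n.
have h3 : 3 * s <= w / n%:R.
  by move: n1; rewrite ler_pdivlMr // ler_pdivlMr // mulrC.
have h6 : w / n%:R <= 6 * s.
  move: n2; rewrite -(natr1 n) ltr_pdivrMr // ler_pdivrMr // => n2.
  have : s <= s * n%:R by rewrite ler_peMr // ltW.
  lra.
have /fin_all_exists[qp hqp] : forall j : 'I_n, exists qp : nat * int,
    [/\ (0 < qp.1)%N, (qp.1 <= Q)%N, simult x a qp.1 &
        `|qp.1%:R * grid u w n j - qp.2%:~R| < rho].
  move=> j; have [|q [q0 qQ qx [p hp]]] := @dirichlet_real R l x (grid u w n j) a Q a_gt0 a_le1.
    apply: le_trans Ql; have : C1 = 2 * 2 ^+ l by rewrite /C1 exprS.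
    have : 0 <= (2 : R) ^+ l by rewrite exprn_ge0.
    by move: C1w DM0; rewrite /M; clear; lra.
  by exists (q, p).
pose J : {pred 'I_n} := [pred j | (r < (qp j).1)%N].
pose bad : {pred 'I_n} := [pred j | ((qp j).1 <= r)%N].
have large q : (0 < q)%N -> simult x a q -> 4 <= q%:R * w.
  move=> q0 /(simult_lower_bound l0 hx q0); rewrite leNgt => h; apply/negP => qw.
  have q0R : 0 < q%:R :> R by rewrite ltr0n.
  have : (4 / w) `^ (- tau) <= q%:R `^ (- tau).
    rewrite !powRN lef_pV2 ?posrE ?powR_gt0 ?divr_gt0 //.
    apply: ge0_ler_powR; rewrite ?nnegrE //; first by rewrite divr_ge0 // ltW.
    by rewrite ler_pdivlMr // ltW.
  move=> /(ler_wpM2l (ltW c0)); rewrite leNgt => /negP; apply.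
  exact: lt_le_trans h aw.
have badle : #|bad|%:R <= 2^-1 * n%:R :> R.
  have fib := @card_fibers_le R _ _ bad (simult_pred x a r)
    (fun j => inord (qp j).1 : 'I_r.+1) (4 * rho * n%:R + 2 * (r%:R * w)).
  apply: le_trans (fib _ _) _.
  - move=> j; rewrite inE => jr; rewrite inE inordK ?ltnS //.
    by have [-> _ qx _] := hqp j; apply/asboolP.
  - move=> q; rewrite inE => /andP[q0 /asboolP qx].
    apply: le_trans (_ : 4 * rho * n%:R + 2 * (q%:R * w) <= _); last first.
      by rewrite lerD2l ler_pM2l // ler_pM2r // ler_nat -ltnS.
    apply: (@card_near_rational _ _ u w rho q _ (fun j => (qp j).2)) => //.
      exact: large.
    move=> j; rewrite inE => /andP[jr /eqP/(congr1 val)] /=.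
    by rewrite inordK ?ltnS // => <-; have [] := hqp j.
  have b0 : 0 <= 4 * rho * n%:R + 2 * (r%:R * w).
    by have := mulr_gt0 rho0 n0R; have := mulr_gt0 r0 w0; lra.
  have M0a : M0 <= r%:R * a `^ tau.
    rewrite -(ler_pM2l Dp) mulrA -QE; apply: le_trans MQ; rewrite /M.
    by move: C1w; lra.
  apply: le_trans (ler_wpM2r b0 (hcount r a a_gt0 aa0 M0a)) _.
  have e1 : rho * (Q%:R * a ^+ l) = C1 by rewrite /rho divfK // gt_eqF.
  have e2 : s * r%:R = rho by rewrite /s divfK // gt_eqF.
  have h6' : w <= 6 * s * n%:R by rewrite -ler_pdivrMr.
  have t1 : C2 * (r%:R * a ^+ l) * (2 * (r%:R * w)) <=
      C2 * (r%:R * a ^+ l) * (2 * (r%:R * (6 * s * n%:R))).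
    rewrite ler_pM2l; first by rewrite ler_pM2l // ler_pM2l.
    by rewrite !mulr_gt0.
  have e3 : C2 * (r%:R * a ^+ l) * rho * D%:R = C1 * C2.
    by rewrite -e1 QE; ring.
  have t2 : C2 * (r%:R * a ^+ l) * (2 * (r%:R * (6 * s * n%:R))) =
    12 * (C2 * (r%:R * a ^+ l) * rho) * n%:R by rewrite -e2; ring.
  have t3 : C2 * (r%:R * a ^+ l) * rho <= 32^-1.
    rewrite -(ler_pM2r Dp) e3; lra.
  have t4 := ler_wpM2r (ltW n0R) t3.
  rewrite mulrDr; move: t1; rewrite t2; lra.
have cJ : (#|J| + #|bad| = n)%N.
  rewrite -[RHS]card_ord -(cardC J); congr (_ + _)%N.
  by apply: eq_card => j; rewrite !inE -leqNgt.
exists n, J, (fun j => (qp j).2%:~R / (qp j).1%:R); split=> //.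
- rewrite -(ler_nat R) natrM; move: badle.
  have -> : n%:R = #|J|%:R + #|bad|%:R :> R by rewrite -natrD cJ.
  lra.
- by rewrite h3.
- move=> j; rewrite inE => rj; have [q0 qQ qx hp] := hqp j.
  have q0R : 0 < (qp j).1%:R :> R by rewrite ltr0n.
  split; last first.
    exists (qp j).1, (qp j).2; split => //.
    by rewrite mulrC divfK // gt_eqF.
  rewrite distrC -(ltr_pM2l q0R) -[X in X * _ < _](ger0_norm (ltW q0R)) -normrM.
  rewrite mulrBr (mulrCA _ _ _^-1) mulfV ?gt_eqF // mulr1.
  apply: lt_trans hp _; rewrite /s mulrCA ltr_pMr // ltr_pdivlMr // mul1r.
  by rewrite ltr_nat.
Qed.

(** * Measure of unions of balls *)

Lemma bigsetU_exists (T : Type) (I : finType) (P : pred I) (B : I -> set T) (y : T) :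
  (\big[setU/set0]_(i | P i) B i) y <-> exists2 i, P i & B i y.
Proof.
split=> [|[i Pi Bi]]; last by rewrite (bigD1 i) //=; left.
by elim/big_ind: _ => // [A A' hA hA' [/hA|/hA']//|i Pi Bi]; exists i.
Qed.

Lemma measurable_ballR (R : realType) (c r : R) : measurable (ball c r : set R).
Proof. by rewrite ball_itv; exact: measurable_itv. Qed.

Lemma measure_le_sum (R : realType) (I : finType) (P : pred I) (A : set R)
    (B : I -> set R) (b : I -> R) :
  measurable A -> (forall i, P i -> measurable (B i)) ->
  (forall y, A y -> exists2 i, P i & B i y) ->
  (forall i, P i -> (lebesgue_measure (B i) <= (b i)%:E)%E) ->
  (lebesgue_measure A <= (\sum_(i | P i) b i)%:E)%E.
Proof.
move=> mA mB AB hb.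
have [mU Ub] : measurable (\big[setU/set0]_(i | P i) B i) /\
    (lebesgue_measure (\big[setU/set0]_(i | P i) B i) <= (\sum_(i | P i) b i)%:E)%E.
  elim/big_rec2: _ => [|i b' U Pi [mU hU]]; first by rewrite measure0.
  split; first by apply: measurableU => //; exact: mB.
  apply: le_trans (measureU2 _ _ _) _ => //; first exact: mB.
  by rewrite EFinD leeD // hb.
apply: le_trans Ub; apply: le_measure; rewrite ?inE // => y /AB h.
exact/bigsetU_exists.
Qed.

(** Bonferroni's inequality for two sets. *)
Lemma measureU_ge (R : realType) (A B : set R) (a b o : R) :
  measurable A -> measurable B -> (lebesgue_measure A < +oo)%E ->
  (a%:E <= lebesgue_measure A)%E -> (b%:E <= lebesgue_measure B)%E ->
  (lebesgue_measure (A `&` B) <= o%:E)%E ->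
  ((a + b - o)%:E <= lebesgue_measure (A `|` B))%E.
Proof.
move=> mA mB Aoo hA hB hAB; rewrite measureUfinl // EFinB EFinD.
by apply: leeB => //; exact: leeD.
Qed.

Definition ballsU (R : realType) (n : nat) (J : {pred 'I_n}) (ctr : 'I_n -> R)
  (r : R) : set R := \big[setU/set0]_(j < n | j \in J) ball (ctr j) r.
Arguments ballsU {R n} J ctr r.

Lemma measurable_ballsU (R : realType) (n : nat) (J : {pred 'I_n}) (ctr : 'I_n -> R)
  (r : R) : measurable (ballsU J ctr r).
Proof. by apply: bigsetU_measurable => i _; exact: measurable_ballR. Qed.

(** Level [k] is a grid of [n k] points, at least half of which carry a ball centred within [s k].
    Skipped levels have [n k = 0], whence the guards [0 < n k]. *)
Section Levels.
Variables (R : realType) (u w : R) (n : nat -> nat).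
Unset Implicit Arguments.
Variables (J : forall k, {pred 'I_(n k)}).
Set Implicit Arguments.
Variables (ctr : forall k, 'I_(n k) -> R).
Variables (s rad : nat -> R).
Hypothesis w0 : 0 < w.
Hypothesis rad0 : forall k, 0 < rad k.
Hypothesis rad16 : forall k, 16 * rad k.+1 <= rad k.
Hypothesis nJ : forall k, (n k <= 2 * #|J k|)%N.
Hypothesis sn : forall k, (0 < n k)%N -> 3 * s k <= w / (n k)%:R <= 6 * s k.
Hypothesis srad : forall k, (0 < n k)%N -> 2 * rad k <= s k.
Hypothesis ctr_grid : forall k (j : 'I_(n k)), j \in J k ->
  `|ctr j - grid u w (n k) j| < s k.

Let n_gt0 k (j : 'I_(n k)) : (0 < n k)%N.
Proof. exact: leq_trans (ltn_ord j). Qed.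

Lemma level_s_gt0 k : (0 < n k)%N -> 0 < s k.
Proof. by move=> /srad; have := rad0 k; lra. Qed.

(** The mesh is at least [3 s] and each centre moves by less than [s]. *)
Lemma level_ctr_separated k (i j : 'I_(n k)) : i \in J k -> j \in J k -> i != j ->
  s k <= `|ctr i - ctr j|.
Proof.
move=> iJ jJ ij; have := @grid_separated _ u w (n k) i j (ltW w0) ij.
have /andP[h3 _] := sn (n_gt0 i).
have := ctr_grid iJ; have := ctr_grid jJ.
rewrite !ltr_norml !ler_normr => /andP[? ?] /andP[? ?] /orP[] ?; apply/orP.
  by left; lra.
by right; lra.
Qed.

(** Displacement plus radius is at most [s + s/2], that is, half the mesh, and the grid consists of
    midpoints. *)
Lemma level_sub k : ballsU (J k) (@ctr k) (rad k) `<=` ball (u + w / 2) (w / 2).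
Proof.
move=> y /bigsetU_exists[j jJ]; have n0 := n_gt0 j.
have /andP[h3 _] := sn n0; have hr := srad n0; have s0 := level_s_gt0 n0.
have n0R : 0 < (n k)%:R :> R by rewrite ltr0n.
have := ctr_grid jJ; rewrite /ball /= !ltr_norml => /andP[c1 c2] /andP[y1 y2].
set h := w / (n k)%:R in h3 *.
have hw : h * (n k)%:R = w by rewrite /h divfK // gt_eqF.
have j1 : j%:R * h + h <= w.
  have : j%:R + 1 <= (n k)%:R :> R by rewrite natr1 ler_nat.
  have hp : 0 <= h by lra.
  by move/(ler_wpM2l hp); rewrite hw; lra.
have j0 : 0 <= j%:R * h by rewrite mulr_ge0 //; lra.
move: c1 c2; rewrite /grid -/h mulrDl => c1 c2.
by apply/andP; split; lra.
Qed.

(** The balls are disjoint because [2 rad <= s], and at least [n/2] of them have length [2 rad]. *)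
Lemma level_measure k :
  (((n k)%:R * rad k)%:E <= lebesgue_measure (ballsU (J k) (@ctr k) (rad k)))%E.
Proof.
rewrite measure_bigsetU_ord_cond; first last.
- apply/trivIsetP => i j iJ jJ ij; apply/seteqP; split=> // y [].
  rewrite /ball /= => yi yj.
  have := level_ctr_separated iJ jJ ij; have := srad (n_gt0 i).
  have := ler_normD (ctr i - y) (y - ctr j); rewrite addrA subrK (distrC y); lra.
- by move=> j _; exact: measurable_ballR.
rewrite (eq_bigr (fun=> (rad k *+ 2)%:E)); last first.
  by move=> j _; apply: lebesgue_measure_ball; exact: ltW.
rewrite sumEFin lee_fin sumr_const -[X in _ <= X *+ _]mulr_natl -[leRHS]mulr_natl.
rewrite mulrA ler_pM2r // -natrM ler_nat mulnC; exact: nJ.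
Qed.

Lemma level_near_card k (z t : R) : 0 <= t ->
  #|[pred j in J k | `|ctr j - z| < t]|%:R <= 12 * t * (n k)%:R / w + 1.
Proof.
move=> t0; have [n0|n0] := posnP (n k).
  rewrite eq_card0 ?n0 ?mulr0 ?mul0r ?add0r // => j.
  by exfalso; have := n_gt0 j; rewrite n0.
have s0 := level_s_gt0 n0; have /andP[_ h6] := sn n0.
apply: le_trans (@card_separated_le _ _ _ (@ctr k) (s k) z t s0 t0 _ _) _.
- by move=> i j; rewrite !inE => /andP[iJ _] /andP[jJ _]; exact: level_ctr_separated.
- by move=> i; rewrite inE => /andP[_ /ltW].
rewrite lerD2r ler_pdivrMr // mulrAC ler_pdivlMr //.
move: h6; rewrite ler_pdivrMr ?ltr0n // => h6.
by have := ler_wpM2l t0 h6; lra.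
Qed.

Lemma rad_mono i k : (i <= k)%N -> rad k <= rad i.
Proof.
move=> /subnK <-; elim: (k - i)%N => // m; apply: le_trans.
by rewrite addSn; have := rad16 (m + i); have := rad0 (m + i).+1; lra.
Qed.

(** A ball of level [k] that meets a given ball of level [i] has its centre within
    [rad i + rad k <= 2 rad i] of the centre of that ball; [level_near_card] counts these
    centres. *)
Lemma level_overlap i k : (i <= k)%N ->
  (lebesgue_measure (ballsU (J i) (@ctr i) (rad i) `&` ballsU (J k) (@ctr k) (rad k))
   <= ((n i)%:R * ((24 * rad i * (n k)%:R / w + 1) * (2 * rad k)))%:E)%E.
Proof.
move=> ik; have mB := measurable_ballsU.
have b0 : 0 <= (24 * rad i * (n k)%:R / w + 1) * (2 * rad k).
  by rewrite mulr_ge0 ?mulr_ge0 ?addr_ge0 ?divr_ge0 ?mulr_ge0 // ltW.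
apply: le_trans (@measure_le_sum _ _ (mem (J i)) _
  (fun j => ball (ctr j) (rad i) `&` ballsU (J k) (@ctr k) (rad k))
  (fun=> (24 * rad i * (n k)%:R / w + 1) * (2 * rad k)) _ _ _ _) _.
- by apply: measurableI; exact: mB.
- by move=> j _; apply: measurableI; [exact: measurable_ballR|exact: mB].
- by move=> y [/bigsetU_exists[j jJ yj] yk]; exists j.
- move=> j jJ.
  apply: le_trans (@measure_le_sum _ _
    [pred j' in J k | `|ctr j' - ctr j| < 2 * rad i] _
    (fun j' => ball (ctr j') (rad k)) (fun=> 2 * rad k) _ _ _ _) _.
  + by apply: measurableI; [exact: measurable_ballR|exact: mB].
  + by move=> j' _; exact: measurable_ballR.
  + move=> y [yj /bigsetU_exists[j' jJ' yj']]; exists j' => //=; rewrite jJ' /=.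
    move: yj yj'; rewrite /ball /= (distrC (ctr j)).
    have := ler_normD (ctr j' - y) (y - ctr j); rewrite addrA subrK.
    by have := rad_mono ik; lra.
  + by move=> j' _; rewrite mulr_natl lebesgue_measure_ball // ltW.
  rewrite sumr_const -[X in X%:E]mulr_natl lee_fin ler_pM2r ?mulr_gt0 //.
  apply: le_trans (level_near_card _ _ _) _; first by rewrite mulr_ge0 // ltW.
  by rewrite lerD2r mulrA -natrM.
rewrite sumr_const -[X in (X%:E <= _)%E]mulr_natl lee_fin ler_wpM2r // ler_nat.
by rewrite -[leqRHS]card_ord max_card.
Qed.

(** The total length if every grid point carried a ball; [level_measure] guarantees half of it. *)
Definition level_mass k : R := 2 * (n k)%:R * rad k.

Definition level_union K : set R :=
  \big[setU/set0]_(k < K) ballsU (J k) (@ctr k) (rad k).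

(* The induction carries the extra term [16/15 e], which absorbs the overlaps coming
   from the [+ 1] of [level_near_card] thanks to the geometric decay of [rad]. *)
Lemma union_measure K S : S = \sum_(k < K) level_mass k ->
  ((S / 2 - 12 * S ^+ 2 / w - S / 15)%:E <= lebesgue_measure (level_union K))%E.
Proof.
move=> SE.
pose e := 2 * (\sum_(k < K) (n k)%:R) * rad K.
apply: (@le_trans _ _ (S / 2 - 12 * S ^+ 2 / w - S / 15 + 16 / 15 * e)%:E).
  by rewrite lee_fin lerDl !mulr_ge0 ?sumr_ge0 // ltW.
rewrite /level_union {}/e {S}SE; elim: K => [|K IH].
  by rewrite !big_ord0 measure0 expr0n /= !(mulr0, mul0r) !subr0 addr0.
rewrite !big_ord_recr /=.
set V := \big[setU/set0]_(k < K) _ in IH *.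
set S := \sum_(k < K) level_mass k in IH *.
set N := \sum_(k < K) (n k)%:R in IH *.
have mV : measurable V by apply: bigsetU_measurable => k _; exact: measurable_ballsU.
pose o := \sum_(i < K) ((n i)%:R * ((24 * rad i * (n K)%:R / w + 1) * (2 * rad K))).
have Voo : (lebesgue_measure V < +oo)%E.
  apply: (@le_lt_trans _ _ (lebesgue_measure (ball (u + w / 2) (w / 2)))).
    apply: le_measure; rewrite ?inE //; first exact: measurable_ballR.
    by move=> y /bigsetU_exists[k _ /level_sub].
  by rewrite lebesgue_measure_ball ?ltry // divr_ge0 // ltW.
have ho : (lebesgue_measure (V `&` ballsU (J K) (@ctr K) (rad K)) <= o%:E)%E.
  apply: (@measure_le_sum _ 'I_K xpredT _
    (fun i => ballsU (J i) (@ctr i) (rad i) `&` ballsU (J K) (@ctr K) (rad K))).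
  - by apply: measurableI => //; exact: measurable_ballsU.
  - by move=> i _; apply: measurableI; exact: measurable_ballsU.
  - by move=> y [/bigsetU_exists[i _ yi] yK]; exists i.
  - by move=> i _; apply: level_overlap; exact: ltnW.
(* The overlaps split into a quasi-independent part, absorbed by the growth of [12 S^2 / w], and the
   part [2 N rad K], which is [e]. *)
have oE : o = 12 * (level_mass K * S) / w + 2 * N * rad K.
  rewrite /o /S /N !(mulr_sumr, mulr_suml) -big_split /=; apply: eq_bigr => i _.
  by rewrite /level_mass; field; rewrite gt_eqF.
apply: le_trans (measureU_ge mV (measurable_ballsU _ _ _) Voo IH (level_measure K) ho).
rewrite lee_fin oE.
have S0 : 0 <= S.
  by apply: sumr_ge0 => k _; rewrite !mulr_ge0 // ltW.
have m0 : 0 <= level_mass K by rewrite !mulr_ge0 // ltW.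
have mE : level_mass K = 2 * (n K)%:R * rad K by [].
have N0 : 0 <= N by apply: sumr_ge0.
(* The decay of [rad] makes [16/15] of the next [e] at most [1/15] of [e + level_mass K]. After
   paying [e] for the overlaps, [level_mass K / 15] is thus the only loss. *)
have hr : 2 * (N + (n K)%:R) * (16 * rad K.+1) <= 2 * (N + (n K)%:R) * rad K.
  by rewrite ler_wpM2l // mulr_ge0 // addr_ge0.
have hw : 0 <= (12 * (level_mass K * S) + 12 * level_mass K ^+ 2) / w.
  apply: divr_ge0; last exact: ltW.
  by have := mulr_ge0 m0 S0; have := sqr_ge0 (level_mass K); lra.
have e1 : 12 * (S + level_mass K) ^+ 2 / w = 12 * S ^+ 2 / w
   + 12 * (level_mass K * S) / w + (12 * (level_mass K * S) + 12 * level_mass K ^+ 2) / w.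
  by field; rewrite gt_eqF.
rewrite e1; move: hw hr mE; set X := _ / w; set Y := _ / w; set Z := 12 * S ^+ 2 / w.
move: (level_mass K) m0 => m m0 hX hr mE; lra.
Qed.

End Levels.

(** * Divergent sums *)

Definition unbounded_sums (R : realType) (v : nat -> R) : Prop :=
  forall B : R, exists K : nat, B <= \sum_(k < K) v k.

Lemma unbounded_sums_le (R : realType) (v v' e : nat -> R) (E : R) :
  (forall k, v k <= v' k + e k) -> (forall K, \sum_(k < K) e k <= E) ->
  unbounded_sums v -> unbounded_sums v'.
Proof.
move=> vv' eE hv B; have [K hK] := hv (B + E); exists K.
have : \sum_(k < K) v k <= \sum_(k < K) (v' k + e k) by apply: ler_sum.
by rewrite big_split /=; have := eE K; lra.
Qed.

Lemma head_sum_le (R : realType) (v : nat -> R) (k1 K : nat) :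
  (forall k, 0 <= v k) ->
  \sum_(k < K) (if (k < k1)%N then v k else 0) <= \sum_(k < k1) v k.
Proof.
move=> v0; apply: (@le_trans _ _ (\sum_(k < minn K k1) v k)).
  elim: K => [|K IH]; first by rewrite big_ord0 sumr_ge0.
  rewrite big_ord_recr /=; case: (ltnP K k1) => Kk.
    have -> : minn K.+1 k1 = K.+1 by apply/minn_idPl.
    have e : minn K k1 = K by apply/minn_idPl; exact: ltnW.
    by move: IH; rewrite e big_ord_recr /= lerD2r.
  have -> : minn K.+1 k1 = k1 by apply/minn_idPr; rewrite (leq_trans Kk).
  have e : minn K k1 = k1 by apply/minn_idPr.
  by move: IH; rewrite e addr0.
rewrite -!(big_mkord xpredT v) [leRHS](@big_cat_nat _ _ _ (minn K k1)) //= ?geq_minr //.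
by rewrite lerDl sumr_ge0.
Qed.

Lemma geometric_sum_le (R : realType) (C rho : R) (K : nat) :
  0 <= C -> 0 <= rho -> rho < 1 -> \sum_(k < K) C * rho ^+ k <= C / (1 - rho).
Proof.
move=> C0 r0 r1; rewrite -mulr_sumr ler_wpM2l // -div1r ler_pdivlMr ?subr_gt0 //.
suff -> : (\sum_(k < K) rho ^+ k) * (1 - rho) = 1 - rho ^+ K.
  by rewrite gerBl exprn_ge0.
elim: K => [|K IH]; first by rewrite big_ord0 mul0r subrr.
by rewrite big_ord_recr /= mulrDl IH exprS; ring.
Qed.

(** If the truncated series converged, its terms would tend to 0, so from some index on the
    truncation would have no effect and the original series would converge as well. *)
Lemma unbounded_sums_min1 (R : realType) (v : nat -> R) :
  (forall k, 0 <= v k) -> unbounded_sums v ->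
  unbounded_sums (fun k => Num.min (v k) 1).
Proof.
move=> v0 hv; apply: contrapT => /existsNP[B hB].
have bd K : \sum_(k < K) Num.min (v k) 1 <= B.
  by rewrite leNgt; apply/negP => h; apply: hB; exists K; exact: ltW.
pose u k := Num.min (v k) 1.
have u0 k : 0 <= u k by rewrite le_min v0 ler01.
have cu : cvgn (series u).
  apply: nondecreasing_is_cvgn.
    by apply: nondecreasing_series => k _ _; exact: u0.
  by exists B => _ [K _ <-]; rewrite /series /= big_mkord.
have := cvg_series_cvg_0 cu => /cvgrPdist_lt /(_ 1 ltr01)[k1 _ hk1].
apply: hB; move: B {bd}.
refine (@unbounded_sums_le _ v u (fun k => if (k < k1)%N then v k else 0)
  (\sum_(k < k1) v k) _ _ hv) => [k|K]; last exact: head_sum_le.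
case: ltnP => kk; first by rewrite lerDr u0.
have := hk1 k kk; rewrite /= sub0r normrN ger0_norm // /u addr0.
by case: (leP (v k) 1); rewrite ?ltxx.
Qed.

(** Cauchy condensation: the block from [16^K] to [16^(K+1)] has [15 * 16^K] terms, each at most
    [psi(16^K)^d]. *)
Lemma condensation (R : realType) (d : nat) (psi : nat -> R) :
  (forall q, (0 < q)%N -> 0 < psi q) ->
  (forall p q, (0 < p)%N -> (p <= q)%N -> psi q <= psi p) ->
  (\sum_(1 <= q <oo) (psi q ^+ d)%:E = +oo)%E ->
  unbounded_sums (fun k => (16 ^ k)%:R * psi (16 ^ k)%N ^+ d).
Proof.
move=> psi0 psim hsum; apply: contrapT => /existsNP[B hB].
have bd K : \sum_(k < K) (16 ^ k)%:R * psi (16 ^ k)%N ^+ d <= B.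
  by rewrite leNgt; apply/negP => h; apply: hB; exists K; exact: ltW.
have step K : \sum_(1 <= q < 16 ^ K) psi q ^+ d <=
    15 * \sum_(k < K) (16 ^ k)%:R * psi (16 ^ k)%N ^+ d.
  elim: K => [|K IH]; first by rewrite big_geq // big_ord0 mulr0.
  have le1 : (1 <= 16 ^ K)%N by rewrite expn_gt0.
  have le2 : (16 ^ K <= 16 ^ K.+1)%N by rewrite leq_exp2l.
  rewrite (@big_cat_nat _ _ _ (16 ^ K)) //= big_ord_recr /= mulrDr lerD //.
  apply: (@le_trans _ _ (\sum_(16 ^ K <= q < 16 ^ K.+1) psi (16 ^ K)%N ^+ d)).
    rewrite big_nat_cond [leRHS]big_nat_cond; apply: ler_sum => q /andP[/andP[q1 q2] _].
    have q0 : (0 < q)%N by apply: leq_trans q1.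
    by apply: lerXn2r; rewrite ?nnegrE ?psim // ltW // psi0.
  rewrite sumr_const_nat expnS -[X in (X - _)%N]/(16 * 16 ^ K)%N.
  have -> : (16 * 16 ^ K - 16 ^ K = 15 * 16 ^ K)%N by rewrite -{2}[(16 ^ K)%N]mul1n -mulnBl.
  by rewrite -[leLHS]mulr_natl natrM mulrA.
have : (\sum_(1 <= q <oo) (psi q ^+ d)%:E <= (15 * B)%:E)%E.
  apply: lime_le.
    apply: is_cvg_nneseries => q q1 _; rewrite lee_fin exprn_ge0 // ltW // psi0 //.
  near=> N; rewrite sumEFin lee_fin.
  have NN : (N <= 16 ^ N)%N by apply: ltnW; exact: ltn_expl.
  have N1 : (1 <= N)%N by near: N; exists 1%N.
  apply: (@le_trans _ _ (\sum_(1 <= q < 16 ^ N) psi q ^+ d)).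
    rewrite [leRHS](@big_cat_nat _ _ _ N) //= lerDl big_nat_cond.
    apply: sumr_ge0 => q /andP[/andP[q1 _] _]; rewrite exprn_ge0 // ltW // psi0 //.
    exact: leq_trans q1.
  by apply: le_trans (step N) _; rewrite ler_pM2l.
by rewrite hsum.
Unshelve. all: by end_near. Qed.

(** Capping at [Q^(-1/d)], [Q = 16^k], preserves divergence by [unbounded_sums_min1]. It makes the
    rate tend to 0 and gives [Q a^d <= 1], which bounds the mass of a single level. *)
Definition trunc_rate (R : realType) (d : nat) (psi : nat -> R) (k : nat) : R :=
  Num.min (psi (16 ^ k)%N) ((16 ^ k)%:R `^ (- d%:R^-1)).

Section TruncRate.
Variables (R : realType) (d : nat) (psi : nat -> R).
Hypothesis d0 : (0 < d)%N.
Hypothesis psi0 : forall q, (0 < q)%N -> 0 < psi q.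
Hypothesis psim : forall p q, (0 < p)%N -> (p <= q)%N -> psi q <= psi p.
Let a := trunc_rate d psi.

Let pow_gt0 k : (0 < 16 ^ k)%N. Proof. by rewrite expn_gt0. Qed.
Let powR0 k : 0 < (16 ^ k)%:R :> R. Proof. by rewrite ltr0n. Qed.

Lemma trunc_rate_gt0 k : 0 < a k.
Proof. by rewrite lt_min psi0 // powR_gt0. Qed.

Lemma trunc_rate_decr k : a k.+1 <= a k.
Proof.
have le : (16 ^ k <= 16 ^ k.+1)%N by rewrite leq_exp2l.
rewrite le_min !ge_min psim //= !powRN lef_pV2 ?posrE ?powR_gt0 //.
by rewrite ge0_ler_powR ?orbT // ?nnegrE ?invr_ge0 // ler_nat.
Qed.

Lemma trunc_rateX k :
  (16 ^ k)%:R * a k ^+ d = Num.min ((16 ^ k)%:R * psi (16 ^ k)%N ^+ d) 1.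
Proof.
have e : (16 ^ k)%:R * ((16 ^ k)%:R `^ (- d%:R^-1)) ^+ d = 1 :> R.
  rewrite -powR_mulrn ?powR_ge0 // -powRrM mulNr mulVf ?pnatr_eq0 -?lt0n //.
  by rewrite powR_inv1 ?mulfV // gt_eqF.
rewrite /a /trunc_rate; set y := (_ `^ _) in e *.
have y0 : 0 < y by rewrite powR_gt0.
have p0 := psi0 (pow_gt0 k).
case: (leP (psi _) y) => h.
  by rewrite min_l // -[leRHS]e ler_pM2l // lerXn2r ?nnegrE // ltW.
by rewrite e min_r // -[leLHS]e ler_pM2l // lerXn2r ?nnegrE // ltW.
Qed.

Lemma trunc_rate_small (a1 : R) : 0 < a1 ->
  exists k1, forall k, (k1 <= k)%N -> a k <= a1.
Proof.
move=> a10; exists (Num.truncn (a1^-1 ^+ d)).+1 => k k1.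
have v0 : 0 <= a1^-1 ^+ d by rewrite exprn_ge0 // invr_ge0 ltW.
have /andP[_ h] := truncn_itv v0.
have h1 : a1^-1 ^+ d <= (16 ^ k)%:R.
  apply: le_trans (ltW h) _; rewrite ler_nat (leq_trans k1) //.
  by apply: ltnW; exact: ltn_expl.
rewrite ge_min powRN; apply/orP; right.
rewrite -[leRHS]invrK lef_pV2 ?posrE ?powR_gt0 ?invr_gt0 //.
have -> : a1^-1 = (a1^-1 ^+ d) `^ d%:R^-1.
  rewrite -powR_mulrn ?invr_ge0 ?ltW // -powRrM mulfV ?pnatr_eq0 -?lt0n //.
  by rewrite powRr1 // invr_ge0 ltW.
by apply: ge0_ler_powR; rewrite ?nnegrE ?invr_ge0.
Qed.

(** If [16^k a^tau < M], then [16^k a^d] is at most [M^p rho^k] with [p = d/tau > 1] and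
    [rho = 16^(1-p) < 1]. The levels to which [local_ubiquity] does not apply therefore have a
    convergent sum. *)
Lemma trunc_rate_selected (tau M : R) (k2 : nat) :
  0 < tau -> tau < d%:R -> 0 < M ->
  (\sum_(1 <= q <oo) (psi q ^+ d)%:E = +oo)%E ->
  unbounded_sums (fun k => if (k2 <= k)%N && (M <= (16 ^ k)%:R * a k `^ tau)
     then (16 ^ k)%:R * a k ^+ d else 0).
Proof.
move=> tau0 taud M0 /(condensation psi0 psim) hc.
have b0 k : 0 <= (16 ^ k)%:R * a k ^+ d.
  by rewrite mulr_ge0 // exprn_ge0 // ltW // trunc_rate_gt0.
have {hc} : unbounded_sums (fun k => (16 ^ k)%:R * a k ^+ d).
  move=> B; have [|K hK] := unbounded_sums_min1 _ hc B.
    by move=> k; rewrite mulr_ge0 // exprn_ge0 // ltW // psi0.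
  by exists K; under eq_bigr do rewrite trunc_rateX.
pose p := d%:R / tau.
have p1 : 1 < p by rewrite /p ltr_pdivlMr // mul1r.
pose rho : R := 16 `^ (1 - p).
have rho0 : 0 <= rho by exact: powR_ge0.
have rho1 : rho < 1.
  rewrite /rho /powR gt_eqF //; rewrite expR_lt1.
  by rewrite nmulr_rlt0 ?subr_lt0 // ln_gt0 // ltr1n.
pose e1 k := if (k < k2)%N then (16 ^ k)%:R * a k ^+ d else 0.
pose E := \sum_(k < k2) (16 ^ k)%:R * a k ^+ d + M `^ p / (1 - rho).
move=> hv; refine (unbounded_sums_le (e := fun k => e1 k + M `^ p * rho ^+ k)
  (E := E) _ _ hv) => [k|K]; last first.
  rewrite big_split /= lerD //; first exact: (@head_sum_le R _ k2 K b0).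
  by apply: geometric_sum_le => //; exact: powR_ge0.
have g0 : 0 <= M `^ p * rho ^+ k by rewrite mulr_ge0 ?powR_ge0 // exprn_ge0.
rewrite /e1; case: (ltnP k k2) => kk /=; first by rewrite add0r lerDl.
case: ifPn => [_|]; first by rewrite add0r lerDl.
rewrite -ltNge !add0r => hM.
have ak := trunc_rate_gt0 k.
have -> : a k ^+ d = (a k `^ tau) `^ p.
  by rewrite -powRrM /p mulrC divfK ?gt_eqF // powR_mulrn // ltW.
have le : a k `^ tau <= M / (16 ^ k)%:R by rewrite ler_pdivlMr // mulrC ltW.
have : (a k `^ tau) `^ p <= (M / (16 ^ k)%:R) `^ p.
  apply: ge0_ler_powR => //; rewrite ?nnegrE ?powR_ge0 //; first by lra.
  by rewrite divr_ge0 // ltW.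
move=> /(ler_wpM2l (ltW (powR0 k))) /le_trans; apply.
rewrite powRM ?invr_ge0 ?(ltW M0) // mulrCA ler_pM2l ?powR_gt0 //.
have -> : rho ^+ k = (16 ^ k)%:R `^ (1 - p).
  rewrite -powR_mulrn // /rho -powRrM mulrC powRrM powR_mulrn //.
  by rewrite natrX.
rewrite powRD; last by apply/implyP => _; rewrite gt_eqF.
by rewrite powRr1 // powRN -powR_inv1 // -powRrM mulN1r powRN.
Qed.

End TruncRate.

(** * The divergence case *)

(** An open set for each [q0]; the intersection over [q0] is the set of [y] with infinitely many
    solutions. *)
Definition simult_from (R : realType) (l : nat) (x : 'rV[R]_l) (psi : nat -> R)
    (q0 : nat) : set R :=
  [set y | exists (q : nat) (p : int),
    [/\ (q0 <= q)%N, (0 < q)%N, simult x (psi q) q & `|q%:R * y - p%:~R| < psi q]].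

Lemma simult_from_measurable (R : realType) (l : nat) (x : 'rV[R]_l)
    (psi : nat -> R) (q0 : nat) : measurable (simult_from x psi q0).
Proof.
apply: measurable_realfun.open_measurable; rewrite openE => y [q [p [q0q q1 qx hy]]].
have qR : 0 < q%:R :> R by rewrite ltr0n.
rewrite /interior; apply/nbhs_ballP.
exists ((psi q - `|q%:R * y - p%:~R|) / q%:R) => /=.
  by rewrite divr_gt0 // subr_gt0.
move=> z; rewrite /ball /= ltr_pdivlMr // => hz; exists q, p; split => //.
have := ler_normD (q%:R * (z - y)) (q%:R * y - p%:~R).
have -> : q%:R * (z - y) + (q%:R * y - p%:~R) = q%:R * z - p%:~R by ring.
rewrite normrM (ger0_norm (ltW qR)) (distrC z); lra.
Qed.

(** By Lebesgue's density theorem [G] has density 0 at almost every point outside it, whereas the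
    sets [V] in the balls around that point keep the density at least [eta]. *)
Lemma ae_of_local_density (R : realType) (G : set R) (eta : R) :
  0 < eta -> measurable G ->
  (forall u w : R, 0 < w -> exists V, [/\ measurable V, V `<=` G,
     V `<=` ball (u + w / 2) (w / 2) & ((eta * w)%:E <= lebesgue_measure V)%E]) ->
  {ae @lebesgue_measure R, forall y, G y}.
Proof.
move=> eta0 mG hV; have hd := lebesgue_density mG.
move: hd; apply: filter_app; first exact: (ae_filter_ringOfSetsType lebesgue_measure).
apply: aeW => y hy; apply: contrapT => nG.
suff : (eta%:E <= (\1_G y)%:E)%E.
  by rewrite indicE memNset // lee_fin leNgt eta0.
apply: (cvge_to_ge hy).
near=> r.
have r0 : 0 < r by near: r; exact: nbhs_right_gt.
have [V [mV VG VB hm]] := hV (y - r) (2 * r) (mulr_gt0 (ltr0n R 2) r0).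
have e : (2 * r) / 2 = r by field.
rewrite e subrK in VB.
rewrite lebesgue_measure_ball ?(ltW r0) // inver gt_eqF ?mulrn_wgt0 //.
rewrite lee_pdivlMr ?mulrn_wgt0 //.
apply: (@le_trans _ _ (lebesgue_measure V)).
  by rewrite -EFinM -mulr_natl.
apply: le_measure; rewrite ?inE //.
  by apply: measurableI => //; exact: measurable_ballR.
by move=> z Vz; split; [exact: VG|exact: VB].
Unshelve. all: by end_near. Qed.

(** The first partial sum to reach [delta] overshoots by at most one term. *)
Lemma exists_window (R : realType) (v : nat -> R) (delta : R) : 0 < delta ->
  (forall k, v k <= delta) -> unbounded_sums v ->
  exists K, delta <= \sum_(k < K) v k <= 2 * delta.
Proof.
move=> d0 vd hv; have exK : exists K, delta <= \sum_(k < K) v k by exact: hv.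
exists (ex_minn exK); case: ex_minnP => K hK Kmin; rewrite hK /=.
case: K hK Kmin => [|K] hK Kmin; first by rewrite big_ord0; lra.
have : \sum_(k < K) v k < delta.
  by rewrite ltNge; apply/negP => /Kmin; rewrite ltnn.
by rewrite big_ord_recr /=; have := vd K; lra.
Qed.

(** Balls around the fractions of [local_ubiquity] at the selected levels [Q = 16^k], over finitely
    many levels of total mass comparable to a small multiple of [w]. At that size the quadratic
    overlap term in [union_measure] is dominated by the linear one. *)
Lemma simult_from_local (R : realType) (l : nat) (x : 'rV[R]_l) (tau c : R)
    (psi : nat -> R) :
  (0 < l)%N -> l%:R <= tau -> tau < l.+1%:R -> 0 < c ->
  (forall n : 'rV[int]_l, n != 0 -> forall m : int,
     c * `|int_vec R n| `^ (- tau) <= `|inner (int_vec R n) x - m%:~R|) ->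
  (forall q, (0 < q)%N -> 0 < psi q) ->
  (forall p q, (0 < p)%N -> (p <= q)%N -> psi q <= psi p) ->
  (\sum_(1 <= q <oo) (psi q ^+ l.+1)%:E = +oo)%E ->
  exists2 eta : R, 0 < eta & forall q0 (u w : R), 0 < w ->
    exists V, [/\ measurable V, V `<=` simult_from x psi q0,
      V `<=` ball (u + w / 2) (w / 2) & ((eta * w)%:E <= lebesgue_measure V)%E].
Proof.
move=> l0 ltau taul c0 hx psi0 psim hsum.
have tau0 : 0 < tau by apply: lt_le_trans ltau; rewrite ltr0n.
have [D0 [C [C1 hub]]] := local_ubiquity l0 ltau c0 hx.
(* A power of 16, so that [D r = 16^k] for [r = 16^(k - D0)]. *)
pose D := (16 ^ D0)%N.
have D0D : (D0 <= D)%N by apply: ltnW; exact: ltn_expl.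
have D_gt0 : (0 < D)%N by rewrite expn_gt0.
have DR : 1 <= D%:R :> R by rewrite ler1n.
(* With [kap = 1/256] the mass [S] lies between [kap w] and [4 kap w], so the quadratic loss is at
   most [48 kap S = 3 S / 16]. What remains, [(1/2 - 3/16 - 1/15) S], exceeds [S / 5], whence
   [eta = kap / 5]. *)
have [kap kap0 kapE] : exists2 kap : R, 0 < kap & kap * 256 = 1.
  by exists 256^-1; [rewrite invr_gt0 ltr0n|rewrite mulVf ?pnatr_eq0].
(* Chosen so that [rad k = c3 g 3 s] with [g = 16^k a^(l+1)]; the mesh bounds then place the mass of
   a selected level between [w c3 g] and [2 w c3 g]. *)
pose c3 : R := kap / (3 * C * D%:R).
have CD0 : 0 < C * D%:R by rewrite mulr_gt0 //; lra.
have CD1 : 1 <= C * D%:R by rewrite (le_trans C1) // ler_peMr //; lra.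
have CD3 : 0 < 3 * C * D%:R by lra.
have c30 : 0 < c3 by rewrite /c3 divr_gt0.
have c3le : c3 <= kap.
  by rewrite /c3 ler_pdivrMr // ler_peMr //; lra.
exists (kap / 5); first by lra.
move=> q0 u w w0.
have {hub} [M [a1 [M0 a10 hub]]] := hub D D0D w w0.
pose a := trunc_rate l.+1 psi.
have a0 k : 0 < a k by exact: trunc_rate_gt0.
have [k1 hk1] := @trunc_rate_small R l.+1 psi (ltn0Sn l) a1 a10.
(* Ensures [a k <= a1], makes [k - D0] a genuine subtraction, and gives [q > 16^(k - D0) >= q0]. *)
pose k2 := (k1 + D0 + q0 + 1)%N.
pose sel k := (k2 <= k)%N && (M <= (16 ^ k)%:R * a k `^ tau).
pose g k : R := if sel k then (16 ^ k)%:R * a k ^+ l.+1 else 0.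
have hg : unbounded_sums g.
  exact: (@trunc_rate_selected R l.+1 psi (ltn0Sn l) psi0 psim tau M k2).
pose s k := C / ((16 ^ k)%:R * a k ^+ l) / (16 ^ (k - D0))%:R.
have levels k : exists L : {n : nat & ({pred 'I_n} * ('I_n -> R))%type},
  let n := projT1 L in let J := (projT2 L).1 in let ctr := (projT2 L).2 in
  if sel k then
   [/\ (0 < n)%N, (n <= 2 * #|J|)%N, 3 * s k <= w / n%:R <= 6 * s k &
      {in J, forall j : 'I_n, `|ctr j - grid u w n j| < s k /\
        exists (q : nat) (p : int), [/\ (16 ^ (k - D0) < q)%N, (q <= 16 ^ k)%N,
          simult x (a k) q & q%:R * ctr j = p%:~R]}]
  else n = 0%N.
  case selk: (sel k); last first.
    by exists (existT _ 0%N ((fun=> false), (fun=> 0))).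
  have /andP[kk2 hM] := selk.
  have kD0 : (D0 <= k)%N by rewrite (leq_trans _ kk2) // /k2 -!addnA addnCA leq_addr.
  have kk1 : (k1 <= k)%N by rewrite (leq_trans _ kk2) // /k2 -!addnA leq_addr.
  have DE : (D * 16 ^ (k - D0) = 16 ^ k)%N by rewrite -expnD subnKC.
  have := hub (16 ^ (k - D0))%N (a k) u (a0 k) (hk1 k kk1).
  rewrite DE => /(_ hM) [n [J [ctr h]]].
  by exists (existT _ n (J, ctr)).
have {levels} [L hL] := choice levels.
pose n k := projT1 (L k).
pose J k : {pred 'I_(n k)} := (projT2 (L k)).1.
pose ctr k : 'I_(n k) -> R := (projT2 (L k)).2.
(* For [q <= 16^k], a point within [rad k] of [p/q] has error at most [kap a k], below [psi q]. *)
pose rad k := kap * a k / (16 ^ k)%:R.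
have P0 k : 0 < (16 ^ k)%:R :> R by rewrite ltr0n expn_gt0.
have rad0 k : 0 < rad k by rewrite divr_gt0 // mulr_gt0.
have rad16 k : 16 * rad k.+1 <= rad k.
  rewrite /rad expnS natrM invfM mulrCA !mulrA mulfK //.
  rewrite ler_pM2r ?invr_gt0 // ler_pM2l //.
  exact: trunc_rate_decr.
have nsel k : (0 < n k)%N -> sel k.
  by move=> nk; have := hL k; case: (sel k) => //=; rewrite -/(n k) => n0; rewrite n0 in nk.
have selE k : sel k -> [/\ (0 < n k)%N, (n k <= 2 * #|J k|)%N,
    3 * s k <= w / (n k)%:R <= 6 * s k &
    {in J k, forall j : 'I_(n k), `|ctr k j - grid u w (n k) j| < s k /\
        exists (q : nat) (p : int), [/\ (16 ^ (k - D0) < q)%N, (q <= 16 ^ k)%N,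
          simult x (a k) q & q%:R * ctr k j = p%:~R]}].
  by move=> sk; have := hL k; rewrite sk.
have nJ k : (n k <= 2 * #|J k|)%N.
  have [n0|/nsel/selE[]//] := posnP (n k).
  by apply: leq_trans (leq0n _); rewrite leqn0 n0.
have sn k : (0 < n k)%N -> 3 * s k <= w / (n k)%:R <= 6 * s k.
  by move=> /nsel/selE[].
have sE k : sel k -> s k = C * D%:R / ((16 ^ k)%:R ^+ 2 * a k ^+ l).
  move=> /andP[kk2 _]; have kD0 : (D0 <= k)%N.
    by rewrite (leq_trans _ kk2) // /k2 -!addnA addnCA leq_addr.
  have DE : D%:R * (16 ^ (k - D0))%:R = (16 ^ k)%:R :> R.
    by rewrite -natrM -expnD subnKC.
  rewrite /s -DE; field.
  by rewrite !gt_eqF ?exprn_gt0 //; lra.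
have ga1 k : (16 ^ k)%:R * a k ^+ l.+1 <= 1.
  by rewrite /a trunc_rateX // ge_min lexx orbT.
have srad k : (0 < n k)%N -> 2 * rad k <= s k.
  move=> /nsel /sE ->; rewrite /rad.
  have e : (C * D%:R / ((16 ^ k)%:R ^+ 2 * a k ^+ l)) =
     C * D%:R * (a k / (16 ^ k)%:R) / ((16 ^ k)%:R * a k ^+ l.+1).
    by rewrite (exprS _ l); field; rewrite !gt_eqF ?exprn_gt0.
  have ap : 0 < a k / (16 ^ k)%:R by rewrite divr_gt0.
  rewrite e ler_pdivlMr ?mulr_gt0 ?exprn_gt0 //.
  apply: (@le_trans _ _ (2 * (kap * a k / (16 ^ k)%:R))).
    by rewrite ler_piMr // !mulr_ge0 ?invr_ge0 // ltW.
  rewrite -!mulrA -/(a k / _) (mulrA C).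
  have : 1 * (a k / (16 ^ k)%:R) <= C * D%:R * (a k / (16 ^ k)%:R) by rewrite ler_pM2r.
  have : kap * (a k / (16 ^ k)%:R) <= 2^-1 * (a k / (16 ^ k)%:R) by rewrite ler_pM2r //; lra.
  lra.
have ctr_grid k (j : 'I_(n k)) : j \in J k -> `|ctr k j - grid u w (n k) j| < s k.
  by move=> jJ; have /nsel/selE[_ _ _ /(_ _ jJ)[]] : (0 < n k)%N by exact: leq_trans (ltn_ord j).
have [K /andP[K1 K2]] : exists K, kap <= \sum_(k < K) c3 * g k <= 2 * kap.
  apply: (@exists_window _ (fun k => c3 * g k)) => //.
    move=> k; rewrite /g; case: ifP => _; last by rewrite mulr0 ltW.
    by apply: le_trans c3le; rewrite ger_pMr.
  move=> B; have [K hK] := hg (B / c3); exists K.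
  by rewrite -mulr_sumr -ler_pdivrMl // mulrC.
have mass k : w * (c3 * g k) <= level_mass n rad k <= w * (2 * (c3 * g k)).
  rewrite /level_mass /g; case: ifP => [sk|sk]; last first.
    have -> : n k = 0%N by have := hL k; rewrite sk.
    by rewrite !mulr0 mul0r lexx.
  have [nk _ /andP[h3 h6] _] := selE k sk.
  have nR : 0 < (n k)%:R :> R by rewrite ltr0n.
  rewrite ler_pdivlMr // in h3; rewrite ler_pdivrMr // in h6.
  have key : c3 * ((16 ^ k)%:R * a k ^+ l.+1) * (3 * s k) = rad k.
    rewrite sE // /c3 /rad (exprS _ l); field.
    by rewrite !gt_eqF ?exprn_gt0 //; lra.
  have G0 : 0 < c3 * ((16 ^ k)%:R * a k ^+ l.+1) by rewrite mulr_gt0 // mulr_gt0 // exprn_gt0.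
  have := ler_wpM2l (ltW G0) h3; have := ler_wpM2l (ltW G0) h6.
  rewrite -key; move: (c3 * _) => G.
  by move=> h6' h3'; apply/andP; split; lra.
pose V := level_union J ctr rad K.
exists V; split.
- by apply: bigsetU_measurable => k _; exact: measurable_ballsU.
- move=> y /bigsetU_exists[k _ /bigsetU_exists[j jJ yj]].
  have n0 : (0 < n k)%N by exact: leq_trans (ltn_ord j).
  have sk := nsel _ n0; have /andP[kk2 _] := sk.
  have [_ _ _ /(_ _ jJ)[_ [q [p [rq qQ qx qp]]]]] := selE k sk.
  have q1 : (0 < q)%N by apply: leq_trans rq.
  have qR : 0 < q%:R :> R by rewrite ltr0n.
  have apsi : a k <= psi q.
    by rewrite /a /trunc_rate ge_min psim.
  exists q, p; split => //.
  + apply: leq_trans (ltnW rq); apply: leq_trans (ltnW (ltn_expl _ (isT : 1 < 16)%N)).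
    rewrite leq_subRL; apply: leq_trans kk2; rewrite /k2 -!addnA addnCA ?leq_addr //.
    by rewrite leq_add2l addnCA leq_addr.
  + by move=> i; have [p' hp'] := qx i; exists p'; exact: lt_le_trans apsi.
  + rewrite -qp -mulrBr normrM (ger0_norm (ltW qR)) distrC.
    apply: lt_le_trans apsi; apply: (@lt_le_trans _ _ (q%:R * rad k)).
      by rewrite ltr_pM2l.
    apply: (@le_trans _ _ ((16 ^ k)%:R * rad k)).
      by rewrite ler_pM2r // ler_nat.
    rewrite /rad mulrC divfK ?gt_eqF //; by rewrite ger_pMl //; lra.
- move=> y /bigsetU_exists[k _ yk]; by apply: (level_sub (s := s)) yk.
- set S := \sum_(k < K) level_mass n rad k.
  have um := union_measure w0 rad0 rad16 nJ sn srad ctr_grid (erefl S).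
  apply: (le_trans _ um); rewrite lee_fin.
  have S1 : w * kap <= S.
    apply: le_trans (_ : w * \sum_(k < K) c3 * g k <= _); first by rewrite ler_pM2l.
    by rewrite mulr_sumr; apply: ler_sum => k _; have /andP[] := mass k.
  have S2 : S <= w * (4 * kap).
    apply: (@le_trans _ _ (w * (2 * \sum_(k < K) c3 * g k))); last by rewrite ler_pM2l //; lra.
    by rewrite !mulr_sumr; apply: ler_sum => k _; have /andP[] := mass k.
  have S3 : 12 * S ^+ 2 / w <= S * (48 * kap).
    rewrite ler_pdivrMr // expr2; nra.
  have kE : 48 * kap = 3 / 16 by lra.
  rewrite kE in S3; lra.
Qed.

(** * Transference for the line *)

(* The factor [B] makes the denominators multiples of [B], hence arbitrarily large. *)
Lemma near_hyperplane_approx (R : realType) (l : nat) (x : 'rV[R]_l) (y : R)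
    (n : 'rV[int]_l) (m : int) (i0 : 'I_l) (N H : nat) :
  (0 < H)%N -> H = absz (n 0 i0) -> (forall j, (absz (n 0%R j) <= H)%N) ->
  forall B : nat, (0 < B)%N -> 5 * l%:R * B%:R <= N.+1%:R :> R ->
  `|inner (int_vec R n) x - m%:~R| * N.+1%:R ^+ l.+1 <= 1 ->
  exists q : nat, [/\ (0 < q)%N, (q <= N.+1 ^ l * (5 * l * H))%N,
    (forall j, exists p : int, `|(q * B)%:R * x 0 j - p%:~R| <= 6 * l%:R * B%:R / N.+1%:R) &
    exists p : int, `|(q * B)%:R * y - p%:~R| <= 6 * l%:R * B%:R / N.+1%:R].
Proof.
move=> H0 HE nH B B0 BN hd.
have l0 : (0 < l)%N by apply: leq_trans (ltn_ord i0).
have lR : 1 <= l%:R :> R by rewrite ler1n.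
have BR : 1 <= B%:R :> R by rewrite ler1n.
have HR : 1 <= H%:R :> R by rewrite ler1n.
have NR : 0 < N.+1%:R :> R by rewrite ltr0n.
set Q := (N.+1 ^ l * (5 * l * H))%N.
set delta := inner (int_vec R n) x - m%:~R in hd.
pose z j : R := B%:R * x 0 j.
(* Coordinate [i0] is given up in favour of [y]; it is recovered from the others through the
   relation [<n,x> ~ m]. *)
pose v j : R := if j == i0 then B%:R * y else z j.
pose fl (q : nat) j : int := Num.floor (q%:R * z j).
(* Up to the small term [q B delta], this integer is the combination of the fractional parts with
   coefficients [n j]. *)
pose k (q : nat) : int := q%:Z * (B%:Z * m) - \sum_j n 0 j * fl q j.
have nR j : `|(n 0 j)%:~R : R| <= H%:R.
  by rewrite -intr_norm -abszE ler_nat.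
have kE q : \sum_j (n 0 j)%:~R * fracpart (q%:R * z j) = q%:R * B%:R * delta + (k q)%:~R.
  have -> : \sum_j (n 0 j)%:~R * fracpart (q%:R * z j) =
      q%:R * B%:R * inner (int_vec R n) x - (\sum_j n 0 j * fl q j)%:~R.
    rewrite rmorph_sum /inner mulr_sumr -sumrB; apply: eq_bigr => j _ /=.
    by rewrite /fracpart /fl /z intrM !mxE; ring.
  by rewrite /k /delta intrB !intrM; ring.
have qd q : (q <= Q)%N -> `|q%:R * B%:R * delta| <= 5 * l%:R * H%:R * B%:R / N.+1%:R.
  move=> qQ; rewrite 2!normrM !normr_nat ler_pdivlMr //.
  have qR : q%:R <= N.+1%:R ^+ l * (5 * l%:R * H%:R) :> R.
    by rewrite -natrX -!natrM ler_nat.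
  have d0 : 0 <= `|delta| by [].
  apply: (@le_trans _ _ (N.+1%:R ^+ l * (5 * l%:R * H%:R) * B%:R * `|delta| * N.+1%:R)).
    by rewrite !ler_wpM2r // ltW.
  rewrite (_ : _ * N.+1%:R = (5 * l%:R * H%:R * B%:R) * (`|delta| * N.+1%:R ^+ l.+1)).
    by rewrite ler_piMr // !mulr_ge0.
  by rewrite exprSr; ring.
have qd1 q : (q <= Q)%N -> `|q%:R * B%:R * delta| <= H%:R.
  move=> /qd /le_trans; apply; rewrite ler_pdivrMr //.
  by have := ler_wpM2l (le_trans ler01 HR) BN; lra.
pose L := (l * H)%N.
have L0 : (0 < L)%N by rewrite muln_gt0 l0.
have kb q : (q <= Q)%N -> (absz (k q) <= 2 * L)%N.
  move=> qQ; rewrite -(ler_nat R) natr_absz intr_norm.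
  have -> : (k q)%:~R = \sum_j (n 0 j)%:~R * fracpart (q%:R * z j) - q%:R * B%:R * delta.
    by rewrite kE; ring.
  apply: le_trans (ler_normB _ _) _.
  have h1 := qd1 q qQ.
  have h2 : `|\sum_j (n 0 j)%:~R * fracpart (q%:R * z j)| <= l%:R * H%:R.
    apply: le_trans (ler_norm_sum _ _ _) _.
    apply: le_trans (ler_sum (G := fun=> H%:R) _ _) _.
      move=> j _; have /andP[f0 f1] := fracpart_itv (q%:R * z j).
      by rewrite normrM -[leRHS]mulr1 ler_pM // ger0_norm // ltW.
    by rewrite sumr_const card_ord -[leLHS]mulr_natl.
  have h3 : H%:R <= l%:R * H%:R :> R by rewrite ler_peMl //; lra.
  by rewrite /L !natrM; lra.
(* Since [|k q| <= 2 L] with [L = l H], there are [4 L + 1 <= 5 L] values of [k]; this explains the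
   factor [5 l H] in [Q]. *)
pose f (q : nat) := ([ffun j : 'I_l => cell N (q%:R * v j)],
   inord (absz (k q + (2 * L)%N%:Z)) : 'I_(4 * L).+1).
have [|i [j [ij jQ [fij kij]]]] := @pigeonhole_leq _ Q f.
  rewrite card_prod card_ffun !card_ord /Q -mulnA leq_mul2l -/L; apply/orP; right.
  by move: L0; clear; lia.
have iQ : (i <= Q)%N by apply: leq_trans jQ; exact: ltnW.
have kk : k i = k j.
  move: kij => /(congr1 val) /=; have := kb i iQ; have := kb j jQ.
  by move: (k i) (k j) => ki kj; clear; move=> h1 h2; rewrite !inordK; lia.
exists (j - i)%N; split; first by rewrite subn_gt0.
- by rewrite (leq_trans (leq_subr _ _)).
- move=> t.
  pose e t := fracpart (j%:R * z t) - fracpart (i%:R * z t).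
  have eE t' : exists p : int, e t' = ((j - i) * B)%:R * x 0 t' - p%:~R.
    exists (fl j t' - fl i t'); rewrite /e /fracpart /fl /z natrM natrB ?(ltnW ij) // intrB.
    by ring.
  have [p pE] := eE t; exists p; rewrite -pE.
  have small t' : t' != i0 -> `|e t'| <= N.+1%:R^-1.
    move=> ti; have /ffunP/(_ t') := fij; rewrite !ffunE /v (negPf ti) => h.
    exact: ltW (cell_eq (esym h)).
  have [->{t p pE}|ti] := eqVneq t i0; last first.
    apply: le_trans (small _ ti) _; rewrite -[leLHS]mul1r ler_pM2r ?invr_gt0 //.
    by have := mulr_ege1 lR BR; lra.
  (* As [k] agrees at [i] and [j], the combination of the differences [e t] is tiny. Solving for the
     term [i0], whose coefficient has maximal modulus [H], bounds [e i0]: [5 l B / N.+1] comes from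
     [delta] and [l / N.+1] from the other coordinates. *)
  have sumE : \sum_t (n 0 t)%:~R * e t = (j - i)%:R * B%:R * delta.
    rewrite /e; under eq_bigr do rewrite mulrBr.
    by rewrite sumrB !kE kk natrB ?(ltnW ij) //; ring.
  move: sumE; rewrite (bigD1 i0) //= => /(canRL (addrK _)) sumE.
  have Hn : `|(n 0 i0)%:~R : R| = H%:R by rewrite -intr_norm -abszE HE.
  have H1 : 0 < H%:R :> R by lra.
  rewrite -(ler_pM2l H1) -[X in X * _ <= _]Hn -normrM sumE.
  apply: le_trans (ler_normB _ _) _.
  have h1 := qd (j - i)%N (leq_trans (leq_subr _ _) jQ).
  have h2 : `|\sum_(t < l | t != i0) (n 0 t)%:~R * e t| <= l%:R * H%:R / N.+1%:R.
    apply: le_trans (ler_norm_sum _ _ _) _.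
    apply: (@le_trans _ _ (\sum_(t < l) H%:R / N.+1%:R)); last first.
      by rewrite sumr_const card_ord -[leLHS]mulr_natl mulrA.
    rewrite big_mkcond /=; apply: ler_sum => t _; case: ifP => [ti|_].
      by rewrite normrM ler_pM // small.
    by rewrite divr_ge0 // ltW.
  apply: le_trans (lerD h1 h2) _.
  rewrite -mulrDl mulrA ler_pM2r ?invr_gt0 //.
  have h3 : l%:R * H%:R <= l%:R * H%:R * B%:R :> R.
    by rewrite ler_peMr // mulr_ge0.
  by lra.
- exists (Num.floor (j%:R * (B%:R * y)) - Num.floor (i%:R * (B%:R * y))).
  have /ffunP/(_ i0) := fij; rewrite !ffunE /v eqxx => /esym/cell_eq/ltW.
  rewrite /fracpart natrM natrB ?(ltnW ij) // intrB.
  rewrite (_ : _ - _ - _ = (j%:R - i%:R) * B%:R * y -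
    ((Num.floor (j%:R * (B%:R * y)))%:~R - (Num.floor (i%:R * (B%:R * y)))%:~R)); last by ring.
  move/le_trans; apply; rewrite -[leLHS]mul1r ler_pM2r ?invr_gt0 //.
  by have := mulr_ege1 lR BR; lra.
Qed.

Lemma infinite_int_vec_unbounded (R : realType) (l : nat) (E : set 'rV[int]_l) :
  infinite_set E -> forall W : nat, exists2 n, E n & W%:R <= `|int_vec R n|.
Proof.
move=> infE W; apply: contrapT => h; apply: infE.
pose g (k : {ffun 'I_l -> 'I_(2 * W).+1}) : 'rV[int]_l := \row_i ((k i : nat)%:Z - W%:Z).
apply: (@sub_finite_set _ _ (range g)); last exact: finite_image.
move=> n En; have nW i : (absz (n 0%R i) <= W)%N.
  rewrite leqNgt; apply/negP => Wi; apply: h; exists n => //.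
  apply: le_trans (sup_norm_ge (int_vec R n) i).
  by rewrite mxE -intr_norm -abszE ler_nat ltnW.
exists [ffun i => inord (absz (n 0%R i + W%:Z))] => //.
apply/rowP => i; rewrite mxE ffunE; have := nW i.
by move: (n 0 i) => z; clear; move=> zW; rewrite inordK; lia.
Qed.

Lemma unbounded_infinite_nat (A : set nat) :
  (forall B : nat, exists2 q, A q & (B <= q)%N) -> infinite_set A.
Proof.
move=> hA /finite_seqP[s sA]; have [q] := hA (\max_(q <- s) q).+1.
rewrite sA /= => qs; rewrite ltnNge => /negP; apply.
exact: (leq_bigmax_seq (F := id)).
Qed.

(** With [H = |n|] and [N ~ H^(tau/d)], the previous construction gives [q] of order at most
    [N^(l + th)], [th = d/tau < 1], with error of order [1/N]. As [l + th < d], this error beats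
    [q^(-1/d)] by a power of [q]. *)
Lemma line_VWA (R : realType) (l : nat) (x : 'rV[R]_l) : (0 < l)%N ->
  (l.+1%:R%:E < dual_type x)%E -> line (d := l.+1) x `<=` VWA (R := R) (d := l.+1).
Proof.
move=> l0 /ereal_sup_gt[_ [tau [tau0 inf_tau] <-]]; rewrite lte_fin => dtau _ [y _ <-].
set d : R := l.+1%:R in dtau *.
have d0 : 0 < d by rewrite ltr0n.
have lR : 1 <= l%:R :> R by rewrite ler1n.
have dE : d = l%:R + 1 by rewrite natr1.
pose th := d / tau.
have th1 : th < 1 by rewrite /th ltr_pdivrMr // mul1r.
have th0 : 0 < th by rewrite divr_gt0.
have lth : 0 < l%:R + th by lra.
(* Midway between [(l + th)/d] and 1: the exponent [ee = kap / (l + th)] still exceeds [1/d], while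
   the spare factor [N^(1 - kap)] swallows the constants. *)
pose kap := ((l%:R + th) / d + 1) / 2.
have lthd : (l%:R + th) / d < 1 by rewrite ltr_pdivrMr // mul1r dE; lra.
have kap1 : kap < 1 by rewrite /kap; move: (_ / d) lthd => v hv; lra.
have kapgt : (l%:R + th) / d < kap by rewrite /kap; move: (_ / d) lthd => v hv; lra.
pose ee := kap / (l%:R + th).
have eegt : d^-1 < ee.
  by rewrite /ee ltr_pdivlMr // mulrC.
have ee0 : 0 < ee by apply: lt_trans eegt; rewrite invr_gt0.
exists (ee - d^-1); first by rewrite subr_gt0.
apply: unbounded_infinite_nat => B0; pose B := B0.+1.
have BR : 1 <= B%:R :> R by rewrite ler1n.
pose C : R := 6 * l%:R * B%:R * (10 * l%:R * B%:R) `^ ee.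
have lB : 1 <= l%:R * B%:R :> R by exact: mulr_ege1.
have C0 : 0 < C by rewrite mulr_gt0 ?powR_gt0 //; lra.
(* A threshold for [N]: the first term gives [C < N^(1 - kap)], the second the hypothesis
   [5 l B <= N] of [near_hyperplane_approx]. *)
pose X := C `^ (1 - kap)^-1 + 5 * l%:R * B%:R + 2.
have X0 : 0 <= X by have := powR_ge0 C (1 - kap)^-1; rewrite /X; lra.
pose H0 := (2 * (Num.truncn X).+1)%N.
have [n [n0 hn] nH0] := infinite_int_vec_unbounded R inf_tau H0.
have [i0 [ni0 nE nmax]] := int_vec_norm_nat R n0.
set H := absz (n 0 i0) in ni0 nE nmax.
rewrite nE in hn nH0.
have HR : 1 <= H%:R :> R by rewrite ler1n.
have [m hm] := dist_int_lt hn.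
(* Then [N^d <= Y^d = H^tau], as the smallness of [<n,x> - m] requires, and [H <= Y <= 2 N] turns
   the threshold [2 X] on [H] into [X <= N]. *)
pose Y := H%:R `^ (tau / d).
have HY : H%:R <= Y.
  by apply: le1r_powR => //; rewrite ler_pdivlMr // mul1r ltW.
pose N := Num.truncn Y.
have Y0 : 0 <= Y by exact: powR_ge0.
have /andP[N1 N2] := truncn_itv Y0; rewrite -/N in N1 N2.
have N0 : (0 < N)%N by rewrite truncn_gt0 (le_trans HR).
have NE : N = N.-1.+1 by rewrite prednK.
have NR1 : 1 <= N%:R :> R by rewrite ler1n.
have NR0 : 0 < N%:R :> R by rewrite ltr0n.
have YN : Y <= 2 * N%:R by move: N2; rewrite -natr1; lra.
have XN : X <= N%:R.
  have /andP[_ h] := truncn_itv X0.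
  have : 2 * X <= H%:R.
    by apply: le_trans nH0; rewrite /H0 natrM ler_pM2l // ltW.
  lra.
have delta : `|inner (int_vec R n) x - m%:~R| * N%:R ^+ l.+1 <= 1.
  have NH : N%:R ^+ l.+1 <= H%:R `^ tau.
    have -> : H%:R `^ tau = Y ^+ l.+1.
      by rewrite -powR_mulrn // -powRrM divfK // gt_eqF.
    by rewrite lerXn2r ?nnegrE.
  have Ht0 : 0 < H%:R `^ tau by rewrite powR_gt0; lra.
  apply: (@le_trans _ _ (H%:R `^ (- tau) * H%:R `^ tau)).
    by rewrite ler_pM ?exprn_ge0 // ltW.
  by rewrite powRN mulVf // gt_eqF.
have CX : 0 <= C `^ (1 - kap)^-1 by exact: powR_ge0.
have := @near_hyperplane_approx R l x y n m i0 N.-1 H ni0 erefl nmax B isT.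
rewrite -NE => /(_ _ delta)[]; first by rewrite /X in XN; lra.
move=> q [q0 qQ hx hy].
have final : 6 * l%:R * B%:R / N%:R < (q * B)%:R `^ (- d^-1 - (ee - d^-1)).
  have -> : - d^-1 - (ee - d^-1) = - ee by ring.
  have qB0 : 0 < (q * B)%:R :> R by rewrite ltr0n muln_gt0 q0.
  have Hth : H%:R <= 2 * N%:R `^ th.
    have -> : H%:R = Y `^ th.
      rewrite -powRrM /th mulrA divfK ?gt_eqF // mulfV ?gt_eqF //.
      by rewrite powRr1.
    apply: (@le_trans _ _ ((2 * N%:R) `^ th)).
      by apply: ge0_ler_powR; [exact: ltW|rewrite nnegrE|rewrite nnegrE mulr_ge0|].
    rewrite powRM // ler_pM2r ?powR_gt0 //.
    by apply: ler1_powR; [rewrite ler1n|exact: ltW].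
  have qle : (q * B)%:R <= 10 * l%:R * B%:R * N%:R `^ (l%:R + th).
    apply: (@le_trans _ _ ((N ^ l * (5 * l * H)) * B)%N%:R).
      by rewrite ler_nat leq_mul2r qQ orbT.
    rewrite powRD; last by apply/implyP => _; rewrite gt_eqF.
    rewrite powR_mulrn // !natrM natrX.
    have p0 : 0 <= N%:R ^+ l * (5 * l%:R) * B%:R :> R by rewrite !mulr_ge0 ?exprn_ge0.
    by have := ler_wpM2l p0 Hth; lra.
  have : (q * B)%:R `^ ee <= (10 * l%:R * B%:R) `^ ee * N%:R `^ kap.
    apply: (@le_trans _ _ ((10 * l%:R * B%:R * N%:R `^ (l%:R + th)) `^ ee)).
      by apply: ge0_ler_powR; rewrite ?nnegrE //; exact: ltW.
    rewrite powRM ?powR_ge0 ?mulr_ge0 // -powRrM.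
    by rewrite (mulrC _ ee) /ee divfK // gt_eqF.
  move=> qee; rewrite powRN ltr_pdivrMr // [ltRHS]mulrC ltr_pdivlMr ?powR_gt0 //.
  have l6 : 0 < 6 * l%:R * B%:R :> R by lra.
  apply: (@le_lt_trans _ _ (C * N%:R `^ kap)).
    by rewrite /C -[leRHS]mulrA ler_pM2l.
  have Nk : N%:R = N%:R `^ (1 - kap) * N%:R `^ kap :> R.
    rewrite -powRD ?subrK ?powRr1 //.
    by apply/implyP => _; rewrite gt_eqF.
  rewrite [ltRHS]Nk ltr_pM2r ?powR_gt0 //.
  have k0 : 0 < 1 - kap by lra.
  have -> : C = (C `^ (1 - kap)^-1) `^ (1 - kap).
    by rewrite -powRrM mulVf ?gt_eqF // powRr1 // ltW.
  apply: gt0_ltr_powR; rewrite ?nnegrE //.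
  by move: XN; rewrite /X; lra.
exists (q * B)%N; last by rewrite (leq_trans (leqnSn B0)) // leq_pmull.
split; first by rewrite muln_gt0 q0.
apply: line_point_approx; first by rewrite powR_gt0 // ltr0n muln_gt0 q0.
- by move=> j; have [p hp] := hx j; exists p; apply: le_lt_trans final.
- by have [p hp] := hy; exists p; apply: le_lt_trans final.
Qed.

(** Each set [simult_from x psi q0] has full measure, and so does their countable intersection over
    [q0]. *)
Lemma khintchine_line (R : realType) (l : nat) (x : 'rV[R]_l) : (0 < l)%N ->
  (dual_type x < l.+1%:R%:E)%E -> khintchine_divergence_line (d := l.+1) x.
Proof.
move=> l0 hx psi psi0 psim hsum.
have ll : l%:R < l.+1%:R :> R by rewrite ltr_nat.
have [tau [c [ltau taul c0 hc]]] := dual_type_lt_lower_bound (ler0n R l) ll hx.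
have [eta eta0 hloc] := simult_from_local l0 ltau taul c0 hc psi0 psim hsum.
have hae q0 : {ae @lebesgue_measure R, forall y, simult_from x psi q0 y}.
  apply: (ae_of_local_density eta0); first exact: simult_from_measurable.
  exact: hloc.
have := ae_foralln hae.
apply: negligibleS => y ny hy; apply: ny; apply: unbounded_infinite_nat => B.
have [q [p [Bq q1 qx qy]]] := hy B; exists q => //; split => //.
by apply: line_point_approx; [exact: psi0|exact: qx|exists p].
Qed.

Unset Implicit Arguments.

Theorem theorem1p2 (R : realType) (d : nat) (hd : (2 <= d)%N)
    (x : 'rV[R]_d.-1) :
  ((d%:R%:E < dual_type x)%E -> line x `<=` VWA (R := R) (d := d)) /\
  ((dual_type x < d%:R%:E)%E -> khintchine_divergence_line x).
Proof.
case: d hd x => // l l1 x; split; first exact: line_VWA.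
exact: khintchine_line.
Qed.
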